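(* Let $n\ge2$ be an integer. All polynomial tau-functions of the $n$-KdV hierarchy are, up to a nonzero constant factor, of the form $$\tau^n_{\lambda_1,\ldots,\lambda_k}(t;c_{\overline{\lambda_1}},c_{\overline{\lambda_2-1}},\ldots,c_{\overline{\lambda_k-k+1}})=\det\left(s_{\lambda_i+j-i}(t_1+c_{1,\overline{\lambda_i-i+1}},\,t_2+c_{2,\overline{\lambda_i-i+1}},\ldots)\right)_{1\le i,j\le k},$$ where $\overline{i}$ denotes the residue class of $i$ modulo $n$, $\lambda=(\lambda_1,\lambda_2,\ldots,\lambda_k)$ is an $n$-periodic partition, and the $c_{\overline{i}}=(c_{1\overline{i}},c_{2\overline{i}},\ldots)$, for $i=1,2,\ldots,n$ (where at most $n-1$ of such $\overline{i}$'s appear), are arbitrary constants. That is, every polynomial tau-function of the $n$-KdV hierarchy is a nonzero constant multiple of such a determinant, and conversely for every $n$-periodic partition $\lambda$ and all complex constants $c_{\overline{i}}$ this determinant is a polynomial tau-function of the $n$-KdV hierarchy.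
   Context: Let $t=(t_1,t_2,\ldots)$ and $y=(y_1,y_2,\ldots)$. The elementary Schur polynomials $s_j(t)$ are defined by $\exp\left(\sum_{i\ge1}t_iz^i\right)=\sum_{j\ge0}s_j(t)z^j$, and $s_j(t)=0$ for $j<0$. Write $[z]=(z,\frac{z^2}{2},\frac{z^3}{3},\ldots)$ and ${\rm Res}\,\sum_i f_iz^i\,dz=f_{-1}$. A polynomial tau-function of the $n$-KdV ($n$-th Gelfand-Dickey) hierarchy is a nonzero polynomial $\tau\in\mathbb{C}[t_1,t_2,\ldots]$ satisfying, identically in $t$ and $y$ (as formal power series in $t,y$ after expanding the exponential), $${\rm Res}\ z^{jn}\,\tau(t-[z^{-1}])\,\tau(y+[z^{-1}])\exp\left(\sum_{i=1}^\infty(t_i-y_i)z^i\right)dz=0\qquad\text{for all } j=0,1,2,\ldots.$$ A partition is a finite weakly decreasing sequence of positive integers $\lambda=(\lambda_1,\ldots,\lambda_k)$ (possibly empty, in which case the determinant is $1$). To it one associates the set $$V_\lambda=\{\lambda_1,\lambda_2-1,\lambda_3-2,\ldots,\lambda_k-k+1,-k,-k-1,-k-2,\ldots\}.$$ The partition $\lambda$ is called $n$-periodic if $V_\lambda$ is mapped into itself when subtracting $n$ from each element. *)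

(* Defs.v *)
(* MathComp, with {malg K[{cmonom I}]} (multinomials) as the ring of
   polynomials over K in the variables I, where I may be infinite.

   Sequences (x_1, x_2, ...) are indexed from 0: x : nat -> A stands for the
   sequence whose (i+1)-st term is x i. *)
From HB Require Import structures.
From mathcomp Require Import all_boot all_order all_algebra.
From mathcomp Require Import finmap.
From mathcomp Require Import reals complex monalg.

Set Implicit Arguments.
Unset Strict Implicit.
Unset Printing Implicit Defensive.

Import GRing.Theory.
Local Open Scope ring_scope.

(* K[t_1, t_2, ...] *)
Notation tpoly K := {malg K[{cmonom nat}]}.

(* K[t_1, t_2, ..., y_1, y_2, ...] *)
Notation typoly K := {malg K[{cmonom (nat + nat)%type}]}.

Definition mvar (K : fieldType) (I : choiceType) (i : I) :
  {malg K[{cmonom I}]} := << ucm i >>.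

Definition tvar (K : fieldType) (i : nat) : typoly K :=
  @mvar K (nat + nat)%type (inl i).

Definition yvar (K : fieldType) (i : nat) : typoly K :=
  @mvar K (nat + nat)%type (inr i).

(* p(x_1, x_2, ...), the coefficients of p being mapped to S by f *)
Definition teval (K : fieldType) (S : comNzRingType) (f : {rmorphism K -> S})
    (x : nat -> S) (p : tpoly K) : S :=
  mmap f (fun m : {cmonom nat} => \prod_(i <- finsupp m) x i ^+ m i) p.

(* s_j(x), the coefficient of z^j in
   exp (\sum_(i >= 1) x_i z^i) = \sum_k (\sum_(i >= 1) x_i z^i)^k / k!.
   Only k <= j and the x_i with i <= j contribute to that coefficient, which
   allows the truncations below ('X plays the role of z). *)
Definition schurN (K : fieldType) (A : algType K) (x : nat -> A) (j : nat) : A :=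
  \sum_(k < j.+1) (k`!%:R^-1 : K) *: (('X * \poly_(i < j) x i) ^+ k)`_j.

Definition schur (K : fieldType) (A : algType K) (x : nat -> A) (j : int) : A :=
  if j is Posz m then schurN x m else 0.

(* The sequence [w] = (w, w^2/2, w^3/3, ...), with 'X for w *)
Definition bracket (K : fieldType) (A : comAlgType K) (i : nat) : {poly A} :=
  (i.+1%:R^-1 : K)%:A *: 'X^(i.+1).

(* Res z^N p(z^-1) (\sum_l f_l z^l) dz, i.e. the coefficient of z^-1 there:
   the term p_m z^(N - m) f_l z^l has degree -1 iff l = m - N - 1. *)
Definition residue (A : nzRingType) (N : nat) (p : {poly A}) (f : int -> A) : A :=
  \sum_(m < size p) p`_m * f (m%:Z - N%:Z - 1).

(* In tau (t - [z^-1]) and tau (y + [z^-1]), which are polynomials in z^-1,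
   'X stands for z^-1. The coefficients of exp (\sum_i (t_i - y_i) z^i) are the
   s_l(t - y), so that each residue is a polynomial in t and y. *)
Definition KdV_tau (K : fieldType) (n : nat) (tau : tpoly K) : Prop :=
  let ev := teval (polyC \o in_alg (typoly K)) in
  tau != 0 /\
  forall j : nat,
    residue (j * n)%N
      (ev (fun i => (tvar K i)%:P - bracket (typoly K) i) tau *
       ev (fun i => (yvar K i)%:P + bracket (typoly K) i) tau)
      (schur (fun i => tvar K i - yvar K i)) = 0.

Definition is_partition (lam : seq nat) : bool :=
  sorted geq lam && all (leq 1) lam.

(* lambda_(i+1) - (i+1) + 1, the row index i being counted from 0 *)
Definition beta (lam : seq nat) (i : nat) : int := (nth 0%N lam i)%:Z - i%:Z.

Definition Vset (lam : seq nat) (v : int) : Prop :=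
  (exists2 i : nat, (i < size lam)%N & v = beta lam i)
  \/ v <= - (size lam)%:Z.

Definition periodic (n : nat) (lam : seq nat) : Prop :=
  forall v : int, Vset lam v -> Vset lam (v - n%:Z).

(* The class modulo n of lambda_(i+1) - (i+1) + 1; 'Z_n is Z/nZ for n >= 2. *)
Definition row_class (n : nat) (lam : seq nat) (i : nat) : 'Z_n :=
  (beta lam i)%:~R.

(* c r m is the constant c_(m+1, r), for r a residue class modulo n. *)
Definition tau_det (K : fieldType) (n : nat) (lam : seq nat)
    (c : 'Z_n -> nat -> K) : tpoly K :=
  \det (\matrix_(i < size lam, j < size lam)
    schur (fun m => mvar K m + (c (row_class n lam i) m)%:A)
      ((nth 0%N lam i)%:Z + j%:Z - i%:Z)).

(* Main.v *)
Require Import Defs.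
From HB Require Import structures.
From mathcomp Require Import all_boot all_order all_algebra.
From mathcomp Require Import perm finmap ring zify.
From mathcomp Require Import boolp reals complex monalg.

Set Implicit Arguments.
Unset Strict Implicit.
Unset Printing Implicit Defensive.

Import Order.TTheory GRing.Theory Num.Theory.
Local Open Scope ring_scope.

(* Everything is evaluated at points t, y of K^oo, where the bilinear identity
   says that the Laurent series psi(t, z) = tau(t - [z^-1]) exp(sum t_i z^i) and
   psi*(y, z) = tau(y + [z^-1]) exp(- sum y_i z^i) satisfy
   Res z^(jn) psi(t, z) psi*(y, z) dz = 0.

   For tau = det [s_(beta_i + j)(t + c_i)], since
   s_m(t - [z^-1]) = s_m(t) - z^-1 s_(m-1)(t), the series psi(t, z) is a bordered
   determinant, orthogonal to the series f_i = z^(-beta_i) exp(sum c_(m,i) z^m) and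
   to z^k K[[z]], while psi*(y, z) is a combination of the f_i modulo z^k.
   Periodicity makes the span of the f_i and z^k K[[z]] stable under z^n.

   Conversely, let W be the orthogonal of all z^(jn) psi(t, z); it is stable under
   z^n and contains z^k K[[z]] for large k. W modulo z^k has exactly k distinct
   orders of vanishing: at least k because the psi*(y - [x], z) project onto a
   Vandermonde family, at most k because k + 1 of them would give a determinant
   of Schur polynomials, not identically zero, annihilating psi(t, z). These
   orders form V_lambda for an n-periodic lambda. Every power series with constant
   term 1 is exp(sum c_m z^m), so one element of minimal order in each class
   modulo n provides the constants. By Cramer's rule, the corresponding
   determinant tau' satisfies
   tau(t - [u]) tau'(t) = tau(t) tau'(t - [u]), whence tau' = a tau. *)

(** * Congruence modulo powers of X, and Schur polynomials as exponentials *)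

Section EqMod.
Variable A : comNzRingType.

Definition eqmodX (N : nat) (p q : {poly A}) :=
  forall i, (i < N)%N -> p`_i = q`_i.

Lemma eqmodX_mul N p p' q q' :
  eqmodX N p p' -> eqmodX N q q' -> eqmodX N (p * q) (p' * q').
Proof.
move=> hp hq i hi; rewrite !coefM; apply: eq_bigr => j _.
by rewrite hp ?hq //; [apply: leq_ltn_trans (leq_subr _ _) hi | move: (ltn_ord j); lia].
Qed.

Lemma eqmodX_exp N p q k : eqmodX N p q -> eqmodX N (p ^+ k) (q ^+ k).
Proof.
move=> h; elim: k => [|k IH]; first by move=> i _; rewrite !expr0.
by rewrite !exprS; apply: eqmodX_mul.
Qed.

Lemma eqmodX_add N p p' q q' :
  eqmodX N p p' -> eqmodX N q q' -> eqmodX N (p + q) (p' + q').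
Proof. by move=> hp hq i hi; rewrite !coefD hp ?hq. Qed.

End EqMod.

Section Schur.
Variables (K : numFieldType) (A : comAlgType K).
Implicit Types x y : nat -> A.

Lemma coef_Xmul_exp_lt (p : {poly A}) k i : (i < k)%N -> (('X * p) ^+ k)`_i = 0.
Proof. by move=> h; rewrite exprMn coefXnM h. Qed.

Lemma schurN_trunc x j N : (j <= N)%N ->
  schurN x j =
  \sum_(k < N.+1) (k`!%:R^-1 : K) *: (('X * \poly_(i < N) x i) ^+ k)`_j.
Proof.
move=> hj; rewrite /schurN [RHS](bigID (fun k : 'I_N.+1 => (k < j.+1)%N)) /=.
rewrite [X in _ = _ + X]big1 ?addr0; last first.
  by move=> k hk; rewrite coef_Xmul_exp_lt ?scaler0 //; lia.
rewrite (big_ord_widen _ (fun k => (k`!%:R^-1 : K) *: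
   (('X * \poly_(i < j) x i) ^+ k)`_j) (_ : (j.+1 <= N.+1)%N)) //.
apply: eq_bigr => k _; congr (_ *: _).
apply: (@eqmodX_exp _ j.+1) => // i hi.
rewrite !coefXM; case: i hi => //= i hi; rewrite !coef_poly.
by have -> : (i < j)%N by []; have -> : (i < N)%N by lia.
Qed.

Lemma schurN0 x : schurN x 0 = 1.
Proof. by rewrite /schurN big_ord1 expr0 fact0 invr1 scale1r coef1. Qed.

(** These are the coefficients of E' = f' E, where E = exp f and f is the sum of the x_i z^(i+1). *)
Lemma schurN_rec x j :
  (j.+1%:R : K) *: schurN x j.+1 =
  \sum_(i < j.+1) (i.+1%:R : K) *: (x i * schurN x (j - i)).
Proof.
pose N := j.+1; pose f := 'X * \poly_(i < N) x i.
pose c k : A := (k`!%:R^-1 : K)%:A.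
pose E := \sum_(k < N.+1) c k *: f ^+ k.
have EE i : (i <= N)%N -> E`_i = schurN x i.
  move=> hi; rewrite (schurN_trunc _ hi) coef_sum; apply: eq_bigr => k _.
  by rewrite coefZ mulr_algl.
(* Differentiating the truncated exponential loses its last term, but f^N has no coefficient below
   degree N = j + 1. *)
have dE : E^`() = f^`() * (E - c N *: f ^+ N).
  rewrite {2}/E big_ord_recr /= addrK.
  rewrite /E raddf_sum /= big_ord_recl /= expr0 derivZ derivC scaler0 add0r.
  rewrite mulr_sumr; apply: eq_bigr => k _.
  rewrite derivZ deriv_exp /= -scaler_nat scalerA -scalerAr; congr (_ *: _).
  rewrite /bump /= add1n /c mulr_algl -scaler_nat scalerA factS natrM invfM.
  by rewrite mulrAC mulVf ?pnatr_eq0 // mul1r.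
have := congr1 (fun p : {poly A} => p`_j) dE.
rewrite /= coef_deriv EE // -scaler_nat => ->.
rewrite coefM; apply: eq_bigr => i _.
rewrite coefB coefZ coef_Xmul_exp_lt ?mulr0 ?subr0 ?EE; try lia.
rewrite coef_deriv coefXM /= coef_poly.
have -> : (i < N)%N by exact: ltn_ord.
by rewrite -scaler_nat -scalerAl.
Qed.

(** Characteristic zero allows division by j + 1. Several identities between exponentials are proved
    below by checking the recurrence. *)
Lemma schurN_unique x (s : nat -> A) : s 0%N = 1 ->
  (forall j, (j.+1%:R : K) *: s j.+1 =
     \sum_(i < j.+1) (i.+1%:R : K) *: (x i * s (j - i)%N)) ->
  forall j, s j = schurN x j.
Proof.
move=> s0 hs j; elim/ltn_ind: j => -[|j] IH; first by rewrite s0 schurN0.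
apply: (scalerI (_ : (j.+1%:R : K) != 0)); first by rewrite pnatr_eq0.
rewrite hs schurN_rec; apply: eq_bigr => i _.
by rewrite IH // ltnS leq_subr.
Qed.

Lemma schurN_ext x y j : (forall i, (i < j)%N -> x i = y i) ->
  schurN x j = schurN y j.
Proof.
move=> h; rewrite /schurN; apply: eq_bigr => k _; congr (_ *: (('X * _) ^+ _)`_ _).
by apply/polyP => i; rewrite !coef_poly; case: ifP => // /h.
Qed.

(** exp (f + g) = exp f exp g: the product of the two truncated exponentials satisfies the
    differential equation of the sum. *)
Lemma schurND x y m :
  schurN (fun i => x i + y i) m =
  \sum_(a < m.+1) schurN x a * schurN y (m - a).
Proof.
symmetry; move: m; apply: schurN_unique.
  by rewrite big_ord1 !schurN0 mulr1.
move=> j.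
pose E z : {poly A} := \poly_(i < j.+2) schurN z i.
pose D z : {poly A} := \poly_(i < j.+1) ((i.+1%:R : K) *: z i).
have dE z : eqmodX j.+1 (E z)^`() (D z * E z).
  move=> i hi; rewrite coef_deriv coef_poly ltnS hi -scaler_nat schurN_rec coefM.
  apply: eq_bigr => k _; rewrite !coef_poly.
  have -> : (k < j.+1)%N by move: (ltn_ord k); lia.
  have -> : (i - k < j.+2)%N by lia.
  by rewrite -scalerAl.
have cE i : (i < j.+2)%N ->
    (E x * E y)`_i = \sum_(a < i.+1) schurN x a * schurN y (i - a).
  move=> hi; rewrite coefM; apply: eq_bigr => k _; rewrite !coef_poly.
  have -> : (k < j.+2)%N by move: (ltn_ord k); lia.
  by have -> : (i - k < j.+2)%N by lia.
have : eqmodX j.+1 (E x * E y)^`() ((D x + D y) * (E x * E y)).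
  rewrite derivM; have -> : (D x + D y) * (E x * E y) =
      (D x * E x) * E y + E x * (D y * E y) by ring.
  by apply: eqmodX_add; apply: eqmodX_mul.
move=> /(_ j (ltnSn j)); rewrite coef_deriv cE // -scaler_nat => ->.
rewrite coefM; apply: eq_bigr => i _; rewrite cE; last lia.
rewrite coefD !coef_poly.
have -> : (i < j.+1)%N by move: (ltn_ord i); lia.
by rewrite -scalerDr -scalerAl.
Qed.

(** The sum of a^i z^i / i over i >= 1 is -log (1 - a z). *)
Lemma schurN_geom (a : A) m :
  schurN (fun i => (i.+1%:R^-1 : K) *: a ^+ i.+1) m = a ^+ m.
Proof.
symmetry; move: m; apply: schurN_unique => [|j]; first by rewrite expr0.
rewrite (eq_bigr (fun=> a ^+ j.+1)); last first.
  move=> i _; rewrite -scalerAl scalerA divff ?pnatr_eq0 // scale1r -exprD.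
  by congr (_ ^+ _); move: (ltn_ord i); lia.
by rewrite sumr_const card_ord scaler_nat.
Qed.

(* Multiplication of the generating series by 1 / (1 - a z). *)
Lemma schurN_addgeom x (a : A) m :
  schurN (fun i => x i + (i.+1%:R^-1 : K) *: a ^+ i.+1) m.+1 =
  schurN x m.+1 +
  a * schurN (fun i => x i + (i.+1%:R^-1 : K) *: a ^+ i.+1) m.
Proof.
rewrite !schurND big_ord_recr /= subnn schurN0 mulr1 addrC; congr (_ + _).
rewrite mulr_sumr; apply: eq_bigr => i _; rewrite !schurN_geom mulrCA -exprS.
by rewrite subSn // -ltnS.
Qed.

(** s_(N+1) is the variable [x N] plus a polynomial in the earlier ones, so the terms of [x] are
    found one at a time. *)
Lemma schurN_surj (s : nat -> A) : s 0%N = 1 ->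
  forall N, exists x, forall m, (m <= N)%N -> schurN x m = s m.
Proof.
move=> s0; elim=> [|N [x hx]].
  by exists (fun=> 0) => m; rewrite leqn0 => /eqP ->; rewrite schurN0 s0.
pose d := s N.+1 - schurN x N.+1.
exists (fun i => x i + (if i == N then d else 0)) => m; rewrite leq_eqVlt ltnS.
have lo m' y : (m' <= N)%N -> schurN (fun i => y i + (if i == N then d else 0)) m'
    = schurN y m'.
  by move=> h; apply: schurN_ext => i hi; rewrite ifN ?addr0 //; apply/eqP; lia.
case/orP => [/eqP -> | h]; last by rewrite lo ?hx.
apply: (scalerI (_ : (N.+1%:R : K) != 0)); first by rewrite pnatr_eq0.
rewrite schurN_rec big_ord_recr /= eqxx subnn schurN0 mulr1.
under eq_bigr => i _.
  rewrite ifN ?addr0 ?lo ?leq_subr //; last by rewrite neq_ltn ltn_ord.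
  over.
have := schurN_rec x N; rewrite big_ord_recr /= subnn schurN0 mulr1 => e.
rewrite scalerDr addrA -e -scalerDr /d; congr (_ *: _).
by rewrite addrC subrK.
Qed.

End Schur.

(** * Evaluation of polynomials in arbitrarily many variables *)

Section MonomialValue.
Variables (I : choiceType) (S : comNzRingType) (x : I -> S).

Definition mval (m : {cmonom I}) : S := \prod_(i <- finsupp m) x i ^+ m i.

Lemma mvalEw (m : {cmonom I}) (d : {fset I}) : (finsupp m `<=` d)%fset ->
  mval m = \prod_(i <- d) x i ^+ m i.
Proof.
move=> le; rewrite /mval (big_fset_incl _ le) //.
by move=> i _; rewrite -cmE_eq0 => /eqP ->; rewrite expr0.
Qed.

Lemma mval_mmorphism : mmorphism mval.
Proof.
split=> [m1 m2|]; last by rewrite /mval mdom1 big_seq_fset0.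
rewrite /mval mdomD -/(mval m1) -/(mval m2).
rewrite (mvalEw (fsubsetUl _ (finsupp m2))) (mvalEw (fsubsetUr (finsupp m1) _)).
by rewrite -big_split /=; apply: eq_bigr => i _; rewrite cmM exprD.
Qed.

HB.instance Definition _ :=
  monalg.isMultiplicative.Build {cmonom I} S mval mval_mmorphism.

Lemma mvalU i : mval (ucm i) = x i.
Proof. by rewrite /mval mdomU big_seq_fset1 cmUU expr1. Qed.

End MonomialValue.

Section PolyEval.
Variables (K : fieldType) (I : choiceType).

Definition peval (S : comNzRingType) (f : {rmorphism K -> S}) (x : I -> S) :
  {malg K[{cmonom I}]} -> S := mmap f (mval x).

HB.instance Definition _ S f x :=
  GRing.RMorphism.copy (@peval S f x) (mmap f (mval x)).

Lemma peval_mvar (S : comNzRingType) (f : {rmorphism K -> S}) x i :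
  peval f x (mvar K i) = x i.
Proof. by rewrite /peval mmapU /= rmorph1 mul1r mvalU. Qed.

Lemma pevalZ (S : comNzRingType) (f : {rmorphism K -> S}) x c p :
  peval f x (c *: p) = f c * peval f x p.
Proof. exact: mmapZ. Qed.

Lemma peval_ext (S : comNzRingType) (f g : {rmorphism K -> S}) x y p :
  f =1 g -> x =1 y -> peval f x p = peval g y p.
Proof.
move=> fg xy; apply: eq_bigr => m _; rewrite fg; congr (_ * _).
by apply: eq_bigr => i _; rewrite xy.
Qed.

Lemma peval_comp (S S' : comNzRingType) (f : {rmorphism K -> S})
    (phi : {rmorphism S -> S'}) x p :
  phi (peval f x p) = peval (phi \o f) (phi \o x) p.
Proof.
rewrite /peval !mmapE rmorph_sum; apply: eq_bigr => m _.
rewrite rmorphM /=; congr (_ * _); rewrite rmorph_prod; apply: eq_bigr => i _.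
by rewrite rmorphXn.
Qed.

End PolyEval.

Section Faithful.
Variables (K : numFieldType) (I : choiceType).
Implicit Types (x : I -> K) (p : {malg K[{cmonom I}]}).

(* The argument is Dedekind's: monomials are distinct characters of the
   multiplicative monoid of points, and f (x * y) - m1 (y) f (x) has a smaller
   support. *)
Lemma peval_faithful p : (forall x, peval idfun x p = 0) -> p = 0.
Proof.
have [N] := ubnP #|` msupp p|; elim: N p => // N IH p ltN hp.
apply/eqP; rewrite -msupp_eq0; apply/negP => /negP /fset0Pn [m1 m1p].
have key m y : p@_m * (mval y m - mval y m1) = 0.
  pose q : {malg K[{cmonom I}]} :=
    [malg m in msupp p => p@_m * (mval y m - mval y m1)].
  have qE k : q@_k = p@_k * (mval y k - mval y m1).
    by rewrite mcoeffE; case: msuppP; rewrite ?mul0r.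
  rewrite -qE; suff -> : q = 0 by rewrite mcoeff0.
  have sq : (msupp q `<=` msupp p)%fset.
    by apply/fsubsetP => k; rewrite -!mcoeff_neq0 qE mulf_eq0 negb_or => /andP[].
  apply: IH => [|x].
    apply: leq_trans (_ : #|` msupp p| <= N)%N; last by rewrite -ltnS.
    apply: fproper_ltn_card; rewrite fproperEneq sq andbT.
    apply/eqP => e; move: m1p; rewrite -e -mcoeff_neq0 qE subrr mulr0 eqxx //.
  have := hp (fun i => x i * y i); rewrite /peval mmapE => h1.
  have := hp x; rewrite /peval mmapE => h2.
  rewrite /peval (mmapEw sq).
  transitivity (\sum_(k <- msupp p) idfun p@_k * mval (fun i => x i * y i) k
    - mval y m1 * \sum_(k <- msupp p) idfun p@_k * mval x k); last first.
    by rewrite h1 h2 mulr0 subr0.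
  rewrite mulr_sumr -sumrB; apply: eq_bigr => k _; rewrite /= qE.
  have -> : mval (fun i => x i * y i) k = mval x k * mval y k.
    by rewrite /mval -big_split; apply: eq_bigr => i _; rewrite exprMn.
  by ring.
have supp1 m : m \in msupp p -> m = m1.
  rewrite -mcoeff_neq0 => pm; apply/eqP/cmP => i.
  (* At this point a monomial [m] takes the value 2^(m i), which recovers the exponent of [i]. *)
  pose y j : K := if j == i then 2 else 1.
  have yE k : mval y k = 2 ^+ k i.
    rewrite (mvalEw _ (fsubsetUl (finsupp k) [fset i]%fset)).
    rewrite (big_fsetD1 i) /=; last by rewrite !inE eqxx orbT.
    rewrite /y eqxx big1_fset ?mulr1 // => j; rewrite in_fsetD1 => /andP[].
    by move=> /negbTE -> _ _; rewrite expr1n.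
  have /eqP := key m y; rewrite mulf_eq0 (negbTE pm) /= !yE subr_eq0.
  by rewrite -!natrX eqr_nat eqn_exp2l // => /eqP.
have := hp (fun=> 1); rewrite /peval (mmapEw (d := [fset m1]%fset)); last first.
  by apply/fsubsetP => m /supp1 ->; rewrite inE.
rewrite big_seq_fset1 /mval big1 => [|i _]; last by rewrite expr1n.
by rewrite mulr1 => /eqP; rewrite /= mcoeff_eq0 m1p.
Qed.

End Faithful.

Section SchurMorph.
Variables (K : numFieldType) (A B : comAlgType K) (phi : {rmorphism A -> B}).
Hypothesis phiZ : forall a u, phi (a *: u) = a *: phi u.

Lemma rmorph_schur (x : nat -> A) j : phi (schur x j) = schur (phi \o x) j.
Proof.
case: j => j /=; last by rewrite rmorph0.
rewrite /schurN rmorph_sum; apply: eq_bigr => k _; rewrite phiZ -coef_map /=.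
rewrite rmorphXn rmorphM /= map_polyX; congr (_ *: (('X * _) ^+ _)`_ _).
by apply/polyP => i; rewrite coef_map !coef_poly /=; case: ifP => _; rewrite ?rmorph0.
Qed.

End SchurMorph.

(** * Schur polynomials, shifts and residues at points of K^oo *)

Section Points.
Variable K : numFieldType.
Implicit Types (t y c : nat -> K) (p tau : tpoly K).

Definition ev t p : K := peval idfun t p.

Definition sc t (j : int) : K := schur (t : nat -> K^o) j.

Definition br (u : K) (i : nat) : K := i.+1%:R^-1 * u ^+ i.+1.

Lemma sc_neg t j : j < 0 -> sc t j = 0.
Proof. by case: j. Qed.

Lemma sc0 t : sc t 0 = 1.
Proof. exact: (@schurN0 K K^o). Qed.

Lemma sc_ext t y j : t =1 y -> sc t j = sc y j.
Proof. by move=> /funext ->. Qed.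

(** Terms with m < -b or m > a vanish, a Schur polynomial of negative index being 0; the two
    hypotheses put the rest of the convolution in the range of the sum. *)
Lemma scD t y (a b : int) B : b <= 0 -> a < B%:Z ->
  \sum_(m < B) sc t (a - m%:Z) * sc y (b + m%:Z) = sc (fun i => t i + y i) (a + b).
Proof.
move=> hb ha; have [hab|hab] := ltP (a + b) 0.
  rewrite sc_neg // big1 // => m _; have [h|h] := ltP (a - m%:Z) 0.
    by rewrite sc_neg ?mul0r.
  by rewrite [sc y _]sc_neg ?mulr0 //; lia.
have [k kb] : exists k : nat, b = - k%:Z by exists `|b|%N; lia.
have [s sE] : exists s : nat, a = s%:Z + k%:Z by exists `|(a + b)%R|%N; lia.
have kB : (k + s.+1 <= B)%N by lia.
rewrite {}sE {}kb addrK /sc /= schurND -(big_mkord xpredT (fun m =>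
  sc t (s%:Z + k%:Z - m%:Z) * sc y (- k%:Z + m%:Z))) (big_cat_nat (n := k)) //=; last lia.
rewrite big_nat big1 ?add0r; last first.
  by move=> m /andP[_ h]; rewrite [sc y _]sc_neg ?mulr0 //; lia.
rewrite (big_cat_nat (n := (k + s.+1)%N)) //=; last lia.
rewrite [X in _ + X]big_nat [X in _ + X]big1 ?addr0; last first.
  by move=> m /andP[h _]; rewrite sc_neg ?mul0r //; lia.
rewrite -{1}[k]add0n (addnC k) big_addn addnK big_mkord.
rewrite [RHS](reindex_inj rev_ord_inj) /=; apply: eq_bigr => m _.
rewrite /sc; have -> : s%:Z + k%:Z - (m + k)%N%:Z = (s - m)%N%:Z.
  by move: (ltn_ord m); lia.
have -> : - k%:Z + (m + k)%N%:Z = m%:Z by lia.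
by rewrite /= subSS subKn // -ltnS.
Qed.

Lemma sc_geom u (m : nat) : sc (br u) m = u ^+ m.
Proof. exact: (@schurN_geom K K^o u m). Qed.

(** exp (sum [u]_i z^i) = 1 / (1 - u z), so multiplying by 1 - u z undoes a shift by [u]. *)
Lemma sc_addgeom t u j :
  sc (fun i => t i + br u i) j - u * sc (fun i => t i + br u i) (j - 1) = sc t j.
Proof.
case: j => [[|m]|m].
- by rewrite [sc _ (0%:Z - 1)]sc_neg // mulr0 subr0 !sc0.
- have -> : m.+1%:Z - 1 = m by lia.
  by rewrite /sc /= (@schurN_addgeom K K^o t u m) addrK.
- by rewrite !sc_neg //; try lia; rewrite mulr0 subr0.
Qed.

Lemma sc_surj (s : nat -> K) : s 0%N = 1 ->
  forall N, exists c, forall m, (m <= N)%N -> sc c m = s m.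
Proof. exact: (@schurN_surj K K^o s). Qed.

Lemma ev_schur t c j :
  ev t (schur (fun m => mvar K m + (c m)%:A) j) = sc (fun m => t m + c m) j.
Proof.
rewrite /ev /sc (@rmorph_schur K _ K^o (peval idfun t)); last exact: pevalZ.
congr (@schur K K^o _ j); apply/funext => m /=.
by rewrite rmorphD /= peval_mvar pevalZ rmorph1 mulr1.
Qed.

Lemma ev_tau_det n t lam (c : 'Z_n -> nat -> K) :
  ev t (tau_det lam c) = \det (\matrix_(i < size lam, j < size lam)
    sc (fun m => t m + c (row_class n lam i) m)
       ((nth 0%N lam i)%:Z + j%:Z - i%:Z)).
Proof.
rewrite /ev /tau_det -det_map_mx; congr (\det _); apply/matrixP => i j.
by rewrite !mxE; exact: ev_schur.
Qed.

Lemma ev_faithful p q : (forall t, ev t p = ev t q) -> p = q.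
Proof.
move=> h; apply/eqP; rewrite -subr_eq0; apply/eqP/peval_faithful => t.
by rewrite rmorphB /= -!/(ev _ _) h subrr.
Qed.

Lemma ev_neq0 p : p != 0 -> exists t, ev t p != 0.
Proof.
move=> h; apply: contrapT => /forallNP h0; case/eqP: h.
apply: ev_faithful => t; rewrite /ev rmorph0; apply/eqP/negPn/negP; exact: h0.
Qed.

Definition pshift t (s : nat -> K) p : {poly K} :=
  peval polyC (fun i => (t i)%:P + s i *: 'X^(i.+1)) p.

Lemma horner_pshift t s p u :
  (pshift t s p).[u] = ev (fun i => t i + s i * u ^+ i.+1) p.
Proof.
rewrite /pshift -[LHS]/(horner_eval u _) peval_comp; apply: peval_ext => i /=.
  by rewrite /horner_eval hornerC.
by rewrite /horner_eval !hornerE .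
Qed.

(** A weighted degree of each monomial bounds its degree in ['X]. Uniformity in the point is what
    allows fixed truncations later. *)
Lemma size_pshift p : exists d, forall t s, (size (pshift t s p) <= d)%N.
Proof.
exists (\max_(m <- msupp p) (\sum_(i <- finsupp m) m i * i.+2).+1)%N => t s.
rewrite /pshift /peval mmapE; apply: leq_trans (size_sum _ _ _) _.
rewrite big_seq [leqRHS]big_seq; apply: (big_ind2 leq) => // [a b c' d|m hm].
  by move=> h1 h2; rewrite geq_max !leq_max h1 h2 orbT.
rewrite mul_polyC; apply: leq_trans (size_scale_leq _ _) _.
rewrite /mval; elim/big_rec2: _ => [|i b q _ h]; first by rewrite size_poly1.
apply: leq_trans (size_polyMleq _ _) _.
have hi : (size ((t i)%:P + s i *: 'X^(i.+1))%R <= i.+2)%N.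
  apply: leq_trans (size_polyD _ _) _; rewrite geq_max.
  rewrite (leq_trans (size_polyC_leq1 _)) //= (leq_trans (size_scale_leq _ _)) //.
  by rewrite size_polyXn.
have := size_poly_exp_leq ((t i)%:P + s i *: 'X^(i.+1)) (m i).
have : ((size ((t i)%:P + s i *: 'X^(i.+1))%R).-1 * m i <= m i * i.+2)%N.
  by rewrite mulnC leq_mul2l; apply/orP; right; lia.
have aux (u v w z : nat) :
  (u <= b.+1 -> z <= w -> v <= z.+1 -> (v + u).-1 <= (w + b).+1)%N by lia.
by move=> h1 h2; apply: aux h h1 h2.
Qed.

Lemma residueEw (A : nzRingType) N (p : {poly A}) f d : (size p <= d)%N ->
  residue N p f = \sum_(m < d) p`_m * f (m%:Z - N%:Z - 1).
Proof.
move=> hd; rewrite /residue (big_ord_widen d (fun m => p`_m * f (m%:Z - N%:Z - 1))) //.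
rewrite big_mkcond /=; apply: eq_bigr => m _; case: ltnP => // h.
by rewrite nth_default ?mul0r.
Qed.

Lemma residueM N (p q : {poly K}) f a b : (size p <= a)%N -> (size q <= b)%N ->
  residue N (p * q) f =
  \sum_(l < a) p`_l * \sum_(m < b) q`_m * f (l%:Z + m%:Z - N%:Z - 1).
Proof.
move=> ha hb; pose g m := f (m%:Z - N%:Z - 1).
have hab : (size (p * q)%R <= a + b)%N.
  by apply: leq_trans (size_polyMleq _ _) _; apply: leq_trans (leq_pred _) _; lia.
rewrite (residueEw _ _ hab) (eq_bigr (fun m : 'I__ =>
  \sum_(l < a) p`_l * ('X^l * q)`_m * g m)); last first.
  move=> m _; rewrite -mulr_suml; congr (_ * _).
  rewrite -{1}(coefK p) (poly_def (size p)) mulr_suml coef_sum.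
  rewrite (big_ord_widen a (fun l => (p`_l *: 'X^l * q)`_m)) //.
  rewrite big_mkcond; apply: eq_bigr => l _; case: ltnP => h.
    by rewrite -scalerAl coefZ.
  by rewrite nth_default ?mul0r.
rewrite exchange_big; apply: eq_bigr => l _ /=.
under eq_bigr => m _ do rewrite -mulrA.
rewrite -mulr_sumr; congr (_ * _).
have hl : (l + b <= a + b)%N by rewrite leq_add2r ltnW.
rewrite -(big_mkord xpredT (fun m => ('X^l * q)`_m * g m)).
rewrite (big_cat_nat (n := l)) //=; last lia.
rewrite big_nat big1 ?add0r; last first.
  by move=> m /andP[_ h]; rewrite coefXnM h mul0r.
rewrite (big_cat_nat (n := (l + b)%N)) //=; last by rewrite leq_addr.
rewrite [X in _ + X]big_nat [X in _ + X]big1 ?addr0; last first.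
  move=> m /andP[h _]; rewrite coefXnM; case: ifP; rewrite ?mul0r // => _.
  rewrite nth_default ?mul0r //; apply: leq_trans hb _; lia.
rewrite -{1}[val l]add0n (addnC (val l)) big_addn addnK big_mkord; apply: eq_bigr => m _.
rewrite coefXnM ltnNge leq_addl /=.
by rewrite addnK /g; congr (_ * f _); lia.
Qed.

End Points.

(** * The bilinear identity at points *)

Section KdVPoints.
Variable K : numFieldType.
Implicit Types (t y : nat -> K) (p tau : tpoly K).

Definition shiftm t tau := pshift t (fun i => - i.+1%:R^-1) tau.
Definition shiftp t tau := pshift t (fun i => i.+1%:R^-1) tau.

Lemma horner_shiftm t tau u :
  (shiftm t tau).[u] = ev (fun i => t i - br u i) tau.
Proof. by rewrite horner_pshift; apply: peval_ext => // i; rewrite mulNr. Qed.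

Lemma horner_shiftp t tau u :
  (shiftp t tau).[u] = ev (fun i => t i + br u i) tau.
Proof. by rewrite horner_pshift. Qed.

Lemma br0 i : br 0 i = 0 :> K.
Proof. by rewrite /br expr0n mulr0. Qed.

Lemma shiftm0 t tau : (shiftm t tau)`_0 = ev t tau.
Proof.
by rewrite -horner_coef0 horner_shiftm; apply: peval_ext => // i; rewrite br0 subr0.
Qed.

Let pt t y (s : nat + nat) : K := match s with inl i => t i | inr i => y i end.

Let phi t y : {rmorphism typoly K -> K} := peval idfun (pt t y).

Let phiZ t y c u : phi t y (c *: u) = c * phi t y u.
Proof. exact: pevalZ. Qed.

Let phi_t t y i : phi t y (tvar K i) = t i.
Proof. exact: peval_mvar. Qed.

Let phi_y t y i : phi t y (yvar K i) = y i.
Proof. exact: peval_mvar. Qed.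

Let map_teval t y (x : nat -> {poly typoly K}) z s tau :
  (forall i, map_poly (phi t y) (x i) = (z i)%:P + s i *: 'X^(i.+1)) ->
  map_poly (phi t y) (teval (polyC \o in_alg (typoly K)) x tau) = pshift z s tau.
Proof.
move=> hx; rewrite -[teval _ _ _]/(peval (polyC \o in_alg (typoly K)) x tau).
rewrite peval_comp; apply: peval_ext => i /=; last exact: hx.
by rewrite map_polyC /= pevalZ rmorph1 mulr1.
Qed.

Let map_bracket t y i :
  map_poly (phi t y) (bracket (typoly K) i) = (i.+1%:R^-1 : K) *: 'X^(i.+1).
Proof.
by rewrite /bracket map_polyZ map_polyXn /= pevalZ rmorph1 mulr1.
Qed.

(** Evaluation at (t, y) commutes with the residue, and [peval_faithful] in the variables t and y
    together gives the way back. *)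
Lemma KdV_points n tau : KdV_tau n tau <-> tau != 0 /\
  forall j t y, residue (j * n) (shiftm t tau * shiftp y tau)
    (sc (fun i => t i - y i)) = 0.
Proof.
pose x1 i := (tvar K i)%:P - bracket (typoly K) i.
pose x2 i := (yvar K i)%:P + bracket (typoly K) i.
pose e x := teval (polyC \o in_alg (typoly K)) x tau.
pose s := schur (fun i => tvar K i - yvar K i).
(* Evaluation may kill leading coefficients, so both residues are written with the larger bound by
   [residueEw]. *)
have hs t y q : (size (map_poly (phi t y) q) <= size q)%N by exact: size_poly.
have key t y N : phi t y (residue N (e x1 * e x2) s) =
    residue N (shiftm t tau * shiftp y tau) (sc (fun i => t i - y i)).
  have <- : map_poly (phi t y) (e x1 * e x2) = shiftm t tau * shiftp y tau.
    rewrite rmorphM; congr (_ * _); apply: map_teval => i.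
      rewrite rmorphB /= scaleNr; congr (_ - _); last exact: map_bracket.
      by rewrite map_polyC; congr polyC; exact: phi_t.
    rewrite rmorphD /=; congr (_ + _); last exact: map_bracket.
    by rewrite map_polyC; congr polyC; exact: phi_y.
  have phis j : phi t y (s j) = sc (fun i => t i - y i) j.
    rewrite /s (@rmorph_schur K _ K^o (phi t y)); last exact: phiZ.
    congr (@schur K K^o _ j); apply/funext => i.
    change (phi t y (tvar K i - yvar K i) = t i - y i).
    etransitivity; first exact: (rmorphB (phi t y)).
    congr (_ - _); [exact: phi_t|exact: phi_y].
  move: (e x1 * e x2) => q.
  rewrite (residueEw _ _ (hs t y q)) /residue (rmorph_sum (phi t y)).
  apply: eq_bigr => m _; rewrite (rmorphM (phi t y)) coef_map phis //.
split=> -[t0 h]; split=> // j.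
  by move=> t y; rewrite -key -[RHS](rmorph0 (phi t y)); congr (phi t y _); apply: h.
apply/peval_faithful => z; rewrite -[RHS](h j (z \o inl) (z \o inr)) -key.
by apply: peval_ext => // -[].
Qed.

End KdVPoints.

(** * Functions polynomial on lines, and a criterion of proportionality *)

Section LinePolynomials.
Variable K : numFieldType.
Implicit Types (t x y d : nat -> K) (f g : (nat -> K) -> K).

Lemma poly_nat_eq0 (p : {poly K}) : (forall k : nat, p.[k%:R] = 0) -> p = 0.
Proof.
move=> h; apply: (@roots_geq_poly_eq0 _ _ [seq k%:R | k <- iota 0 (size p)]).
- by apply/allP => _ /mapP[k _ ->]; apply/eqP/h.
- by rewrite map_inj_uniq ?iota_uniq // => a b /eqP; rewrite eqr_nat => /eqP.
- by rewrite size_map size_iota.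
Qed.

Lemma poly_horner_inj (p q : {poly K}) : (forall u, p.[u] = q.[u]) -> p = q.
Proof.
move=> h; apply/eqP; rewrite -subr_eq0; apply/eqP/poly_nat_eq0 => k.
by rewrite hornerD hornerN h subrr.
Qed.

(** This property passes through sums, products and determinants without an explicit polynomial in
    the t_i, and it suffices for cancelling factors. *)
Definition linepoly f := forall x d, exists p : {poly K},
  forall v, f (fun i => x i + v * d i) = p.[v].

Lemma linepoly_ev tau : linepoly (fun t => ev t tau).
Proof.
move=> x d; exists (peval polyC (fun i => (x i)%:P + d i *: 'X) tau) => v.
rewrite -[RHS]/(horner_eval v _) peval_comp; apply: peval_ext => i /=.
  by rewrite /horner_eval hornerC.
by rewrite /horner_eval !hornerE mulrC.
Qed.

Lemma linepoly_sc j : linepoly (fun t => sc t j).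
Proof.
move=> x d; have [p hp] := linepoly_ev (schur (fun m => mvar K m + (0 : K)%:A) j) x d.
by exists p => v; rewrite -hp ev_schur; apply: sc_ext => i; rewrite addr0.
Qed.

Lemma linepoly_ext f g : f =1 g -> linepoly f -> linepoly g.
Proof. by move=> /funext ->. Qed.

Lemma linepoly_cst (c : K) : linepoly (fun=> c).
Proof. by move=> x d; exists c%:P => v; rewrite hornerC. Qed.

Lemma linepolyD f g : linepoly f -> linepoly g -> linepoly (fun t => f t + g t).
Proof.
move=> hf hg x d; have [p hp] := hf x d; have [q hq] := hg x d.
by exists (p + q) => v; rewrite hornerD hp hq.
Qed.

Lemma linepolyM f g : linepoly f -> linepoly g -> linepoly (fun t => f t * g t).
Proof.
move=> hf hg x d; have [p hp] := hf x d; have [q hq] := hg x d.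
by exists (p * q) => v; rewrite hornerM hp hq.
Qed.

Lemma linepoly_shift f y : linepoly f -> linepoly (fun t => f (fun i => t i + y i)).
Proof.
move=> hf x d; have [p hp] := hf (fun i => x i + y i) d.
by exists p => v; rewrite -hp; congr f; apply/funext => i; rewrite addrAC.
Qed.

Lemma linepoly_sum (I : Type) (r : seq I) (P : pred I) (F : I -> (nat -> K) -> K) :
  (forall i, linepoly (F i)) -> linepoly (fun t => \sum_(i <- r | P i) F i t).
Proof.
move=> hF; elim: r => [|i r IH].
  by apply: linepoly_ext (linepoly_cst 0) => t; rewrite big_nil.
case Pi: (P i); last by apply: linepoly_ext IH => t; rewrite big_cons Pi.
by apply: linepoly_ext (linepolyD (hF i) IH) => t; rewrite big_cons Pi.
Qed.

Lemma linepoly_prod (I : Type) (r : seq I) (F : I -> (nat -> K) -> K) :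
  (forall i, linepoly (F i)) -> linepoly (fun t => \prod_(i <- r) F i t).
Proof.
move=> hF; elim: r => [|i r IH].
  by apply: linepoly_ext (linepoly_cst 1) => t; rewrite big_nil.
by apply: linepoly_ext (linepolyM (hF i) IH) => t; rewrite big_cons.
Qed.

Lemma linepoly_det N (F : 'I_N -> 'I_N -> (nat -> K) -> K) :
  (forall i j, linepoly (F i j)) -> linepoly (fun t => \det (\matrix_(i, j) F i j t)).
Proof.
move=> hF; apply: linepoly_sum => s; apply: linepolyM; first exact: linepoly_cst.
apply: (linepoly_ext (f := fun t => \prod_(i < N) F i (s i) t)) => [t|].
  by apply: eq_bigr => i _; rewrite mxE.
exact: linepoly_prod.
Qed.

(** The line from a point where [f] is nonzero to an arbitrary [y] reduces the claim to the domain
    K[v]. *)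
Lemma linepoly_mul_eq0 f g : linepoly f -> linepoly g ->
  (forall t, f t * g t = 0) -> (exists t, f t != 0) -> forall t, g t = 0.
Proof.
move=> hf hg fg [x fx] y.
have [p hp] := hf x (fun i => y i - x i); have [q hq] := hg x (fun i => y i - x i).
have /eqP : p * q = 0.
  by apply: poly_nat_eq0 => k; rewrite hornerM -hp -hq fg.
rewrite mulf_eq0 => /orP[] /eqP e.
  have := hp 0; rewrite e horner0 => fx0; case/eqP: fx; rewrite -fx0.
  by congr f; apply/funext => i; rewrite mul0r addr0.
by have := hq 1; rewrite e horner0 => <-; congr g; apply/funext => i; ring.
Qed.

End LinePolynomials.

Lemma unitmx_Vandermonde (K : fieldType) N (x : 'I_N -> K) : injective x ->
  Vandermonde N (\row_a x a) \in unitmx.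
Proof.
move=> x_inj; rewrite unitmxE det_Vandermonde unitfE; apply/prodf_neq0 => i _.
apply/prodf_neq0 => j ij; rewrite !mxE subr_eq0.
by apply/eqP => /x_inj e; rewrite e ltnn in ij.
Qed.

Section Proportional.
Variable K : numFieldType.
Implicit Types (t x y d : nat -> K).

Lemma ev_local (tau : tpoly K) : exists N, forall t y,
  (forall i, (i < N)%N -> t i = y i) -> ev t tau = ev y tau.
Proof.
exists (\max_(m <- msupp tau) \max_(i <- finsupp m) i.+1)%N => t y h.
rewrite /ev /peval !mmapE big_seq [RHS]big_seq; apply: eq_bigr => m hm.
congr (_ * _); rewrite /mval big_seq [RHS]big_seq; apply: eq_bigr => i hi.
rewrite h //; apply: leq_trans (leq_bigmax_seq _ hm isT).
exact: (@leq_bigmax_seq _ _ xpredT (fun i : nat => i.+1) i hi isT).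
Qed.

(** On the first [N] coordinates the sequences [1], ..., [N] span, by a Vandermonde determinant. *)
Lemma br_span N d : exists v : 'I_N -> K,
  forall i, (i < N)%N -> d i = \sum_a v a * br a.+1%:R i.
Proof.
pose V : 'M[K]_N := Vandermonde N (\row_a a.+1%:R).
have uV : V \in unitmx.
  apply: unitmx_Vandermonde => a b /eqP; rewrite eqr_nat eqSS.
  by move=> /eqP /val_inj.
pose w := invmx V *m (\col_(i < N) (i.+1%:R * d i)).
(* The division compensates for the exponent i + 1 in [br], the Vandermonde matrix having (a +
   1)^i. *)
exists (fun a => w a 0 / a.+1%:R) => i hi.
have := congr1 (fun M : 'cV_N => M (Ordinal hi) 0) (mulKVmx uV (\col_(i < N) (i.+1%:R * d i))).
rewrite -/w !mxE /= => e; apply: (mulfI (_ : i.+1%:R != 0 :> K)).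
  by rewrite pnatr_eq0.
rewrite -{}e mulr_sumr; apply: eq_bigr => a _; rewrite !mxE /br.
have h1 : a.+1%:R != 0 :> K by rewrite pnatr_eq0.
have h2 : i.+1%:R != 0 :> K by rewrite pnatr_eq0.
rewrite exprS; move: (w a 0) (a.+1%:R : K) h1 (i.+1%:R : K) h2 => W A h1 B h2.
by field; rewrite h1 h2.
Qed.

(* The shifts a with tau(t + a) / tau(t) = tau'(t + a) / tau'(t) form an additive
   group; being Zariski closed on lines it is a vector space, and the [u] span. *)
Lemma proportional (tau tau' : tpoly K) :
  (forall t u, ev (fun i => t i - br u i) tau * ev t tau' =
               ev t tau * ev (fun i => t i - br u i) tau') ->
  tau != 0 -> exists a, tau' = a *: tau.
Proof.
move=> h /ev_neq0 [x0 hx0].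
pose rel a := forall t, ev (fun i => t i + a i) tau * ev t tau' =
   ev t tau * ev (fun i => t i + a i) tau'.
have rel_ext a b : a =1 b -> rel a -> rel b by move=> /funext ->.
have rel0 : rel (fun=> 0).
  by move=> t; have -> : (fun i => t i + 0) = t by apply/funext => i; rewrite addr0.
have relD a b : rel a -> rel b -> rel (fun i => a i + b i).
  move=> ha hb.
  (* The relation for a + b holds after multiplication by tau(t + a), a factor that is not
     identically zero. *)
  have := @linepoly_mul_eq0 K (fun t => ev (fun i => t i + a i) tau)
   (fun t => ev (fun i => t i + (a i + b i)) tau * ev t tau' +
     (-1) * (ev t tau * ev (fun i => t i + (a i + b i)) tau')).
  move=> H t; apply/eqP; rewrite -subr_eq0 -mulN1r; apply/eqP; move: t; apply: H.
  - exact: linepoly_shift (linepoly_ev _).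
  - apply: linepolyD; first apply: linepolyM.
    + exact: (linepoly_shift _ (linepoly_ev _)).
    + exact: linepoly_ev.
    apply: linepolyM; first exact: linepoly_cst.
    apply: linepolyM; first exact: linepoly_ev.
    exact: (linepoly_shift _ (linepoly_ev _)).
  - move=> t; have := ha t; have := hb (fun i => t i + a i).
    have -> : (fun i => t i + a i + b i) = (fun i => t i + (a i + b i)).
      by apply/funext => i; rewrite addrA.
    set A := ev _ tau; set B := ev _ tau'; set C := ev _ tau; set D := ev _ tau'.
    move=> e1 e2; rewrite mulrDr mulN1r mulrN.
    apply/eqP; rewrite subr_eq0; apply/eqP.
    transitivity (A * (C * ev t tau')); first by ring.
    by rewrite e2 mulrCA e1; ring.
  - exists (fun i => x0 i - a i).
    by have -> : (fun i => x0 i - a i + a i) = x0 by apply/funext => i; rewrite subrK.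
have relZ a v : rel a -> rel (fun i => v * a i).
  move=> ha t.
  (* Natural multiples suffice, since both sides are polynomial in the multiple. *)
  have hn (k : nat) : rel (fun i => k%:R * a i).
    elim: k => [|k IH]; first by apply: rel_ext rel0 => i; rewrite mul0r.
    by apply: rel_ext (relD _ _ IH ha) => i; rewrite -natr1 mulrDl mul1r.
  have [p hp] := linepoly_ev tau t a; have [q hq] := linepoly_ev tau' t a.
  have : p * (ev t tau')%:P - (ev t tau)%:P * q = 0.
    apply: poly_nat_eq0 => k.
    by rewrite !hornerE -hp -hq hn subrr.
  move=> /(congr1 (horner^~ v)); rewrite !hornerE -hp -hq => /eqP.
  by rewrite subr_eq0 => /eqP.
have relall a : rel a.
  have [N1 loc1] := ev_local tau; have [N2 loc2] := ev_local tau'.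
  have [v hv] := br_span (N1 + N2)%N a.
  have relb : rel (fun i => \sum_b v b * br b.+1%:R i).
    elim: (index_enum _) => [|b s IH].
      by apply: rel_ext rel0 => i; rewrite big_nil.
    have hb : rel (fun i => - br b.+1%:R i) by move=> t; exact: h.
    apply: rel_ext (relD _ _ (relZ _ (- v b) hb) IH) => i.
    by rewrite big_cons mulrNN.
  move=> t.
  have -> : ev (fun i => t i + a i) tau = ev (fun i => t i + \sum_b v b * br b.+1%:R i) tau.
    by apply: loc1 => i hi; rewrite -hv //; lia.
  have -> : ev (fun i => t i + a i) tau' = ev (fun i => t i + \sum_b v b * br b.+1%:R i) tau'.
    by apply: loc2 => i hi; rewrite -hv //; lia.
  exact: relb.
exists (ev x0 tau' / ev x0 tau); apply: ev_faithful => t.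
rewrite {2}/ev pevalZ /= -/(ev _ _).
have := relall (fun i => t i - x0 i) x0.
have -> : (fun i => x0 i + (t i - x0 i)) = t by apply/funext => i; rewrite addrC subrK.
by move=> e; apply: (mulfI hx0); rewrite -e; field.
Qed.

End Proportional.

(** * Determinants of Schur polynomials that are not identically zero *)

Section Nonvanishing.
Variable K : numFieldType.

(** This is the value of s_j at (1, 0, 0, ...). *)
Definition ifact (j : int) : K := if j is Posz m then m`!%:R^-1 else 0.

Lemma ifact_neg j : j < 0 -> ifact j = 0.
Proof. by case: j. Qed.

Lemma sc_single (a : K) (j : nat) :
  sc (fun i => if i == 0%N then a else 0) j = a ^+ j * ifact j.
Proof.
symmetry; move: j; apply: (@schurN_unique K K^o) => [|j].
  by rewrite expr0 mul1r /= fact0 invr1.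
rewrite big_ord_recl /= big1 ?addr0 => [|i _]; last by rewrite mul0r scaler0.
rewrite scale1r subn0 /= factS natrM invfM exprS.
have h : j.+1%:R != 0 :> K by rewrite pnatr_eq0.
rewrite -[LHS]/(j.+1%:R * _) -[RHS]/(a * (a ^+ j * _)).
by move: (j.+1%:R : K) h (j`!%:R^-1 : K) (a ^+ j) => X h Y Z; field.
Qed.

Lemma horner_ffact (n m : nat) :
  (\prod_(a < m) ('X - a%:R%:P)).[n%:R] = (n ^_ m)%:R :> K.
Proof.
elim: m => [|m IH]; first by rewrite big_ord0 hornerC.
rewrite big_ord_recr /= hornerM IH !hornerE ffactnSr natrM.
have [h|h] := leqP m n; first by rewrite natrB.
by rewrite ffact_small ?mul0r.
Qed.

Lemma fact_ifact (n m : nat) : n`!%:R * ifact (n%:Z - m%:Z) = (n ^_ m)%:R.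
Proof.
have [h|h] := leqP m n; last first.
  by rewrite ffact_small // ifact_neg ?mulr0 //; lia.
rewrite -(ffact_fact h) natrM subzn //= mulfK // pnatr_eq0.
by rewrite -lt0n fact_gt0.
Qed.

(** Row i times (nn i)! consists of falling factorials of nn i, so a kernel vector yields a
    polynomial of degree less than [N] with [N] distinct roots. *)
Lemma det_ifact_neq0 N (nn : 'I_N -> nat) : injective nn ->
  \det (\matrix_(i, j) ifact ((nn i)%:Z + j%:Z - N.-1%:Z)) != 0.
Proof.
move=> inj; apply/negP; rewrite -det_tr => /det0P [v v0 hv].
case/eqP: v0; apply/matrixP => i0 j0; rewrite ord1 mxE.
pose p := \sum_j v 0 j *: \prod_(a < N.-1 - j) ('X - a%:R%:P).
have hp n : p.[n%:R] = \sum_j v 0 j * (n ^_ (N.-1 - j))%:R.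
  rewrite horner_sum; apply: eq_bigr => j _.
  by rewrite hornerZ horner_ffact.
have p0 : p = 0.
  apply: (@roots_geq_poly_eq0 _ _ [seq (nn i)%:R | i <- enum 'I_N]).
  - apply/allP => _ /mapP[i _ ->]; apply/eqP; rewrite hp.
    have := congr1 (fun M : 'rV_N => (nn i)`!%:R * M 0 i) hv.
    rewrite !mxE mulr0 mulr_sumr => E; apply: etrans E; apply: eq_bigr => j _.
    rewrite !mxE mulrCA -fact_ifact; congr (_ * (_ * ifact _)).
    by move: (ltn_ord j); lia.
  - rewrite map_inj_uniq ?enum_uniq // => a b /eqP.
    by rewrite eqr_nat => /eqP /inj.
  - rewrite size_map -cardE card_ord; apply: leq_trans (size_sum _ _ _) _.
    apply/bigmax_leqP => j _; apply: leq_trans (size_scale_leq _ _) _.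
    rewrite -(big_mkord xpredT (fun a => 'X - a%:R%:P)) size_prod_XsubC size_iota.
    by move: (ltn_ord j); lia.
(* Falling factorials are independent: at [r] those of degree above [r] vanish, and those of lower
   degree have zero coefficients by induction. *)
have [r hr] : exists r : nat, (N.-1 - j0 = r)%N by exists (N.-1 - j0)%N.
elim/ltn_ind: r j0 hr => r IH j0 hr.
have := hp r; rewrite p0 horner0 (bigD1 j0) //= hr ffactnn big1 ?addr0.
  move=> /esym /eqP; rewrite mulf_eq0 => /orP[/eqP -> //|].
  by rewrite pnatr_eq0 -[_ == _]negbK -lt0n fact_gt0.
move=> j jj0; have [h|h] := ltnP r (N.-1 - j); first by rewrite ffact_small ?mulr0.
rewrite (IH (N.-1 - j)%N) ?mul0r // ltn_neqAle h andbT.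
apply: contra jj0 => /eqP e; apply/eqP/val_inj => /=.
by move: (ltn_ord j) (ltn_ord j0); lia.
Qed.

(* The t-scaling z -> z / eps isolates the leading coefficients [u i 0]. *)
Lemma det_sc_neq0 N (u : 'I_N -> nat -> K) (nn : 'I_N -> nat) :
  (forall i, u i 0%N != 0) -> injective nn ->
  exists t, \det (\matrix_(i < N, j < N) \sum_(m < (nn i).+1)
     u i m * sc t ((nn i)%:Z + j%:Z - N.-1%:Z - m%:Z)) != 0.
Proof.
move=> hu inj; pose a (i j : 'I_N) : int := (nn i)%:Z + j%:Z - N.-1%:Z.
(* At 0 only the [u i 0] survive, and the determinant becomes their product times the one of
   [det_ifact_neq0]. *)
pose G : 'M[{poly K}]_N := \matrix_(i, j)
  \sum_(m < (nn i).+1) (u i m * ifact (a i j - m%:Z)) *: 'X^m.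
have Ge e : (\det G).[e] = \det (\matrix_(i, j)
    \sum_(m < (nn i).+1) (u i m * ifact (a i j - m%:Z)) * e ^+ m).
  rewrite -[LHS]/(horner_eval e _) -det_map_mx; congr (\det _).
  apply/matrixP => i j; rewrite !mxE /= /horner_eval /= horner_sum.
  by apply: eq_bigr => m _; rewrite !hornerE.
have G0 : \det G != 0.
  apply/negP => /eqP /(congr1 (horner^~ 0)); rewrite Ge horner0 => /eqP.
  apply/negP; have := det_ifact_neq0 inj.
  set A := \matrix_(i, j) _ => hA.
  rewrite (_ : \matrix_(i, j) _ = diag_mx (\row_i u i 0%N) *m A); last first.
    apply/matrixP => i j; rewrite mul_diag_mx !mxE big_ord_recl /= subr0 expr0 mulr1.
    by rewrite big1 ?addr0 // => m _; rewrite expr0n mulr0.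
  rewrite det_mulmx mulf_neq0 // det_diag; apply/prodf_neq0 => i _.
  by rewrite mxE.
(* The factor ['X] makes the chosen value [e] nonzero too, so that it can be inverted. *)
have [e1 hk] : exists k : nat, ('X * \det G).[k%:R] != 0.
  apply: contrapT => /forallNP h; case/negP: G0.
  have : 'X * \det G = 0.
    by apply: poly_nat_eq0 => k; apply/eqP/negPn/negP; exact: h.
  by move/eqP; rewrite mulf_eq0 polyX_eq0.
move: hk; rewrite hornerM hornerX mulf_eq0 negb_or => /andP[].
move: (e1%:R : K) => e e0 hk; exists (fun i => if i == 0%N then e^-1 else 0).
apply: contra hk => /eqP hF; rewrite Ge.
set F := (X in \det X = 0) in hF.
set H := (X in \det X == 0).
(* At (1/e, 0, 0, ...) the value of s_j is e^(-j) / j!; scaling row i by e^(nn i) and column j by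
   e^j leaves e^m, up to the common factor. *)
have : e ^+ N.-1 *: H = diag_mx (\row_i e ^+ nn i) *m F *m diag_mx (\row_i e ^+ i).
  apply/matrixP => i j; rewrite mul_mx_diag mul_diag_mx /H /F !mxE.
  rewrite !mulr_sumr mulr_suml; apply: eq_bigr => m _; rewrite /a.
  have [b eb] : exists b, (nn i)%:Z + j%:Z - N.-1%:Z - m%:Z = b by eexists.
  rewrite eb; case: b eb => [k ek|k _]; last first.
    by rewrite ifact_neg // sc_neg // !(mulr0, mul0r).
  rewrite sc_single exprVn.
  have E : e ^+ nn i * e ^+ j = e ^+ N.-1 * e ^+ m * e ^+ k.
    by rewrite -!exprD; congr (_ ^+ _); lia.
  have ek0 : e ^+ k != 0 by rewrite expf_eq0 (negbTE e0) andbF.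
  transitivity ((e ^+ nn i * e ^+ j) * (u i m * ((e ^+ k)^-1 * ifact k))); last by ring.
  rewrite E; move: (e ^+ k) ek0 (e ^+ m) (e ^+ N.-1) (u i m) (ifact k).
  by move=> X X0 Y Z U V; field.
move/(congr1 determinant); rewrite detZ !det_mulmx hF mulr0 mul0r => /eqP.
by rewrite mulf_eq0 !expf_eq0 (negbTE e0) !andbF.
Qed.

End Nonvanishing.

(** * Bordered determinants and Cramer's rule *)

Section Bordered.
Variable K : comNzRingType.

Lemma det_telescope k (G : 'I_k.+1 -> nat -> K) u :
  \det (\matrix_(i, j < k.+1) G i j) =
  \det (\matrix_(i, j < k.+1) if (j : nat) is j'.+1 then G i j'.+1 - u * G i j' else G i 0%N).
Proof.
pose U : 'M[K]_k.+1 := \matrix_(l, j) ((l == j)%:R - u * (l.+1 == j)%:R).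
have detU : \det U = 1.
  rewrite -det_tr det_trig.
    rewrite big1 // => i _; rewrite !mxE eqxx (_ : (i.+1 == i)%N = false) //; last lia.
    by rewrite mulr0 subr0.
  apply/is_trig_mxP => i j ij; rewrite !mxE.
  have -> : (j == i) = false by apply/eqP => e; move: ij; rewrite e; lia.
  have -> : (j.+1 == i)%N = false by lia.
  by rewrite mulr0 subr0.
rewrite -[LHS]mulr1 -detU -det_mulmx; congr (\det _); apply/matrixP => i j.
rewrite !mxE.
rewrite (eq_bigr (fun l : 'I__ => G i l * (l == j)%:R - u * (G i l * (l.+1 == j)%:R))).
  rewrite sumrB -mulr_sumr (bigD1 j) //= eqxx mulr1 big1 ?addr0; last first.
    by move=> l /negbTE ->; rewrite mulr0.
  case: j => -[|j] hj /=.
    by rewrite big1 ?mulr0 ?subr0 // => l _; rewrite mulr0.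
  rewrite (bigD1 (Ordinal (ltnW hj))) //= eqxx mulr1 big1 ?addr0 // => l hl.
  rewrite eqSS (_ : (l == j :> nat) = false) ?mulr0 //.
  by apply/negbTE; apply: contra hl => /eqP e; apply/eqP/val_inj.
by move=> l _; rewrite !mxE mulrBr mulrCA.
Qed.

Variables (k : nat) (F : 'I_k -> nat -> K).

Definition bordered (g : nat -> K) : 'M[K]_k.+1 :=
  \matrix_(a, l) if unlift ord0 a is Some i then F i l else g l.

(** These are the signed maximal minors of [F]; the zero border is only a placeholder. *)
Definition bcof (l : 'I_k.+1) : K := cofactor (bordered (fun=> 0)) ord0 l.

Lemma cofactor_bordered g l : cofactor (bordered g) ord0 l = bcof l.
Proof.
rewrite /bcof /cofactor; congr (_ * \det _); apply/matrixP => i j.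
by rewrite !mxE liftK.
Qed.

Lemma det_bordered g : \det (bordered g) = \sum_(l < k.+1) g l * bcof l.
Proof.
rewrite (expand_det_row _ ord0); apply: eq_bigr => l _.
by rewrite cofactor_bordered mxE unlift_none.
Qed.

(** For the border 1, u, ..., u^k telescoping leaves only the first entry of the border. *)
Lemma det_bordered_geom u :
  \sum_(l < k.+1) u ^+ l * bcof l = \det (\matrix_(i, j < k) (F i j.+1 - u * F i j)).
Proof.
rewrite -det_bordered /bordered.
rewrite (det_telescope (fun a l => if unlift ord0 a is Some i then F i l else u ^+ l) u).
rewrite (expand_det_row _ ord0) big_ord_recl big1 ?addr0 => [|j _]; last first.
  by rewrite mxE unlift_none /= -exprS subrr mul0r.
rewrite mxE unlift_none expr0 mul1r /cofactor expr0 mul1r; congr (\det _).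
by apply/matrixP => i j; rewrite !mxE liftK.
Qed.

Lemma bcof_row i : \sum_(l < k.+1) F i l * bcof l = 0.
Proof.
rewrite -det_bordered; apply: (@determinant_alternate _ _ _ ord0 (lift ord0 i)) => //.
by move=> l; rewrite !mxE unlift_none liftK.
Qed.

(** Cramer's rule: [p] is proportional to the minors of [F]. The cross-multiplied form remains valid
    when minors vanish. *)
Lemma bordered_kernel (p : nat -> K) : (forall i, \sum_(l < k.+1) p l * F i l = 0) ->
  forall u, (\sum_(l < k.+1) p l * u ^+ l) * \det (\matrix_(i, j < k) F i j.+1) =
    p 0%N * \det (\matrix_(i, j < k) (F i j.+1 - u * F i j)).
Proof.
move=> hp u; rewrite -det_bordered_geom -det_bordered.
set g := fun l => u ^+ l; pose v : 'cV[K]_k.+1 := \col_l p l.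
have E : \adj (bordered g) *m (bordered g *m v) = \det (bordered g) *: v.
  by rewrite mulmxA mul_adj_mx mul_scalar_mx.
have Mv i : (bordered g *m v) (lift ord0 i) ord0 = 0.
  rewrite mxE -[RHS](hp i).
  by apply: eq_bigr => l _; rewrite !mxE liftK mulrC.
have <- : (\adj (bordered g) *m (bordered g *m v)) ord0 ord0 = p 0%N * \det (bordered g).
  by rewrite E !mxE mulrC.
rewrite [in RHS]mxE [in RHS]big_ord_recl [X in _ = _ + X]big1 ?addr0 => [|i _]; last first.
  by rewrite Mv mulr0.
rewrite mulrC mxE cofactor_bordered; congr (_ * _).
  rewrite /bcof /cofactor expr0 mul1r; congr (\det _).
  by apply/matrixP => i j; rewrite !mxE liftK.
rewrite mxE; apply: eq_bigr => l _.
by rewrite !mxE unlift_none mulrC.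
Qed.

End Bordered.

(** * Shifts of determinants of Schur polynomials by [u] *)

Section DetSchur.
Variables (K : numFieldType) (k : nat) (b : 'I_k -> int) (g : 'I_k -> nat -> K).
Implicit Types (t y : nat -> K).

Definition detsc t : K :=
  \det (\matrix_(i, j < k) sc (fun m => t m + g i m) (b i + j%:Z)).

(** The addition formula expands row i in Schur polynomials of t with coefficients s_m(g i), the
    first being 1; adding k - 1 makes the row indices natural numbers, as in [det_sc_neq0]. *)
Lemma detsc_neq0 : injective b -> (forall i, - k%:Z < b i) ->
  exists t, detsc t != 0.
Proof.
move=> binj bk; pose nn i := absz (b i + k%:Z - 1)%R.
have nnE i : (nn i)%:Z = b i + k%:Z - 1 by have := bk i; rewrite /nn; lia.
have [||t ht] := @det_sc_neq0 K k (fun i m => sc (g i) m%:Z) nn.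
- by move=> i; rewrite sc0 oner_neq0.
- by move=> i j e; apply: binj; have := nnE i; rewrite e nnE; lia.
exists t; apply: contra ht => /eqP E; apply/eqP; apply: etrans E; congr (\det _).
apply/matrixP => i j; rewrite !mxE -[b i + j%:Z]addr0.
rewrite -(@scD K t (g i) _ 0 (nn i).+1) //; last by have := nnE i; move: (ltn_ord j); lia.
apply: eq_bigr => m _; rewrite add0r mulrC nnE; congr (sc _ _ * _).
by move: (ltn_ord j); lia.
Qed.

(** The offset -1 provides an extra column on the left, from which the telescoping differences
    start. *)
Let F t i (l : nat) := sc (fun m => t m + g i m) (b i + l%:Z - 1).

Lemma detsc_sub_br t u :
  detsc (fun m => t m - br u m) =
  \det (\matrix_(i, j < k) (F t i j.+1 - u * F t i j)).
Proof.
congr (\det _); apply/matrixP => i j; rewrite !mxE -(sc_addgeom _ u) /F.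
have -> : b i + j.+1%:Z - 1 = b i + j%:Z by lia.
have E : (fun m => t m - br u m + g i m + br u m) =1 (fun m => t m + g i m).
  by move=> m; ring.
by rewrite !(sc_ext _ E).
Qed.

Section Minus.
Variables (t : nat -> K) (P : {poly K}).
Hypothesis hP : forall u, P.[u] = detsc (fun m => t m - br u m).

(** The coefficients in [u] are signed minors of [F t]; this bounds the degree and makes them
    orthogonal to the rows. *)
Let PE : P = \poly_(l < k.+1) (if insub l is Some l' then bcof (F t) l' else 0).
Proof.
apply: poly_horner_inj => u; rewrite hP detsc_sub_br -det_bordered_geom.
by rewrite horner_poly; apply: eq_bigr => l _; rewrite valK mulrC.
Qed.

Lemma size_detsc_minus : (size P <= k.+1)%N.
Proof. by rewrite PE size_poly. Qed.

Lemma detsc_minus_kernel i : \sum_(l < k.+1) P`_l * F t i l = 0.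
Proof.
rewrite -[RHS](bcof_row (F t) i); apply: eq_bigr => l _.
by rewrite PE coef_poly ltn_ord valK mulrC.
Qed.

End Minus.

End DetSchur.

Section DetSchurPlus.
Variables (K : numFieldType) (k : nat) (b : 'I_k.+1 -> int) (g : 'I_k.+1 -> nat -> K).
Variables (y : nat -> K) (Q : {poly K}) (B : nat).
Hypothesis hQ : forall u, Q.[u] = detsc b g (fun m => y m + br u m).
Hypothesis hB : forall i, b i < B%:Z.

Let G i (x : int) := sc (fun m => y m + g i m) (b i + x).
Let A := \matrix_(i, j < k.+1) G i j%:Z.

Definition pcof i := cofactor A i ord0.

Lemma pcof_alien (x : nat) : (0 < x <= k)%N ->
  \sum_i pcof i * G i x%:Z = 0.
Proof.
move=> /andP[x0 xk]; have hx : (x < k.+1)%N by [].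
have := congr1 (fun M : 'M_k.+1 => M ord0 (Ordinal hx)) (mul_adj_mx A).
rewrite [RHS]mxE -val_eqE /= (_ : (0 == x)%N = false) ?mulr0n; last by case: x x0 {xk hx}.
by move=> E; apply: etrans E; rewrite mxE; apply: eq_bigr => i _; rewrite !mxE.
Qed.

(** Telescoping undoes the shift by [u] in every column but the first, so the cofactors of that
    column do not depend on [u]. *)
Lemma detsc_plusE : Q = \poly_(m < B) \sum_i pcof i * G i (- m%:Z).
Proof.
apply: poly_horner_inj => u; rewrite hQ horner_poly.
pose H i (j : nat) := sc (fun m => y m + br u m + g i m) (b i + j%:Z).
rewrite /detsc (det_telescope H u) (expand_det_col _ ord0).
under eq_bigr => i _.
  rewrite mxE (_ : cofactor _ i ord0 = pcof i); last first.
    rewrite /pcof /cofactor; congr (_ * \det _); apply/matrixP => i' j.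
    rewrite !mxE /= /bump /= add1n /H /G.
    have -> : (fun m => y m + br u m + g (lift i i') m) =
              (fun m => (y m + g (lift i i') m) + br u m).
      by apply/funext => m; rewrite addrAC.
    rewrite -[RHS](sc_addgeom _ u); congr (_ - _ * sc _ _); lia.
  rewrite /= /H addr0.
  have -> : sc (fun m => y m + br u m + g i m) (b i) =
     \sum_(m < B) G i (- m%:Z) * u ^+ m.
    rewrite -[b i]addr0 (_ : (fun m => _) = (fun m => (y m + g i m) + br u m)); last first.
      by apply/funext => m; rewrite addrAC.
    rewrite -(@scD K _ (br u) (b i) 0 B) //; apply: eq_bigr => m _.
    by rewrite add0r sc_geom.
  rewrite mulrC mulr_sumr.
  over.
rewrite exchange_big; apply: eq_bigr => m _ /=.
by rewrite mulr_suml; apply: eq_bigr => i _; rewrite mulrA.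
Qed.

(* The terms added to the sum vanish, which turns the half-infinite sum into the
   full convolution of the addition formula. *)
Lemma detsc_plus_conv (z : nat -> K) (d : int) : d <= k.+1%:Z ->
  \sum_(m < B) Q`_m * sc (fun i => z i - y i) (d + m%:Z - 1) =
  \sum_i pcof i * sc (fun m => z m + g i m) (b i + d - 1).
Proof.
move=> hd; pose s := sc (fun i => z i - y i).
transitivity (\sum_i pcof i * \sum_(m < B) G i (- m%:Z) * s (d + m%:Z - 1)).
  under [RHS]eq_bigr => i _ do rewrite mulr_sumr.
  rewrite exchange_big; apply: eq_bigr => m _ /=.
  rewrite detsc_plusE coef_poly ltn_ord mulr_suml.
  by apply: eq_bigr => i _; rewrite mulrA.
transitivity (\sum_i pcof i *
    \sum_(m < k.+1 + B) G i (k.+1%:Z - m%:Z) * s (d + m%:Z - k.+1%:Z - 1)); last first.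
  apply: eq_bigr => i _; congr (_ * _).
  have -> : sc (fun m => z m + g i m) (b i + d - 1) =
      sc (fun m => (y m + g i m) + (z m - y m)) ((b i + k.+1%:Z) + (d - k.+1%:Z - 1)).
    by rewrite (_ : b i + k.+1%:Z + _ = b i + d - 1); [apply: sc_ext => m; ring|lia].
  rewrite -(@scD K _ _ _ _ (k.+1 + B)%N); [|lia|by have := hB i; lia].
  by apply: eq_bigr => m _; rewrite /G; congr (sc _ _ * sc _ _); lia.
under [RHS]eq_bigr => i _ do rewrite big_split_ord mulrDr /=.
rewrite big_split /= [X in _ = X + _](_ : _ = 0) ?add0r.
  apply: eq_bigr => i _; congr (_ * _); apply: eq_bigr => m _.
  by congr (G _ _ * s _); lia.
under eq_bigr => i _ do rewrite mulr_sumr.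
rewrite exchange_big /= big1 // => m _.
(* For m = 0 the bound on [d] makes the index of [s] negative; the other added terms are expansions
   with alien cofactors. *)
have [m0|m0] := posnP m.
  by rewrite big1 // => i _; rewrite /s [sc _ (_ - 1)]sc_neg ?mulr0 //; lia.
under eq_bigr => i _ do rewrite mulrA.
rewrite -mulr_suml (_ : k.+1%:Z - m%:Z = (k.+1 - m)%N%:Z); last by move: (ltn_ord m); lia.
by rewrite pcof_alien ?mul0r //; move: (ltn_ord m); lia.
Qed.

End DetSchurPlus.

(** * Periodic partitions and residue classes *)

Section Partitions.
Variable n : nat.
Implicit Types (lam : seq nat) (v : int).

Lemma Vset_sub lam v (j : nat) : periodic n lam -> Vset lam v ->
  Vset lam (v - (j * n)%N%:Z).
Proof.
move=> per hv; elim: j => [|j IH]; first by rewrite mul0n subr0.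
by have := per _ IH; congr Vset; lia.
Qed.

Lemma beta_ltr lam i j : sorted geq lam -> (i < j < size lam)%N ->
  beta lam j < beta lam i.
Proof.
move=> so /andP[ij jk].
have := sorted_leq_nth (rev_trans leq_trans) leqnn 0%N so.
move=> /(_ i j); rewrite !inE jk (ltn_trans ij jk) => /(_ isT isT (ltnW ij)).
by rewrite /beta /=; lia.
Qed.

Lemma beta_inj lam : sorted geq lam ->
  injective (fun i : 'I_(size lam) => beta lam i).
Proof.
move=> so i j e; apply/val_inj; case: (ltngtP i j) => // h.
  by have := @beta_ltr lam i j so; rewrite h ltn_ord e ltxx => /(_ isT).
by have := @beta_ltr lam j i so; rewrite h ltn_ord e ltxx => /(_ isT).
Qed.

Lemma beta_gt lam i : (i < size lam)%N -> - (size lam)%:Z < beta lam i.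
Proof. by rewrite /beta; lia. Qed.

Hypothesis n2 : (2 <= n)%N.

Lemma natZn_eq0 (m : nat) : ((m%:R : 'Z_n) == 0) = (n %| m)%N.
Proof. by rewrite -val_eqE /= val_Zp_nat. Qed.

Lemma class_sub v (j : nat) : (v - (j * n)%N%:Z)%:~R = v%:~R :> 'Z_n.
Proof.
rewrite rmorphB /= -[X in _ - X]/((j * n)%:R) (_ : (j * n)%:R = 0) ?subr0 //.
by apply/eqP; rewrite natZn_eq0 dvdn_mull.
Qed.

(** The class of 1 - k does not occur, k being the number of rows: every [beta] is at least 2 - k,
    so subtracting n repeatedly from one in that class would reach 1 - k, which is not in
    V_lambda. *)
Lemma size_row_classes lam : is_partition lam -> periodic n lam ->
  (size (undup [seq row_class n lam i | i <- iota 0 (size lam)]) <= n.-1)%N.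
Proof.
move=> /andP[_ pos] per; set k := size lam.
have bpos i : (i < k)%N -> 2 - k%:Z <= beta lam i.
  by move=> hi; have := all_nthP 0%N pos i hi; rewrite /beta; lia.
pose r0 : 'Z_n := (1 - k%:Z)%:~R.
have -> : n.-1 = size (enum (predC1 r0)).
  by rewrite -cardE cardC1 card_ord Zp_cast.
apply: uniq_leq_size; first exact: undup_uniq.
move=> r; rewrite mem_undup mem_enum inE => /mapP[i0].
move: i0 => i; rewrite mem_iota => /andP[_ hi] ->.
apply/negP => /eqP e; have hb := bpos i hi.
have [m hm] : exists m : nat, beta lam i = 1 - k%:Z + m%:Z.
  by exists (absz (beta lam i - 1 + k%:Z)%R); lia.
have : (n %| m)%N.
  rewrite -natZn_eq0; apply/eqP; apply: (addrI r0); rewrite addr0; apply: etrans e.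
  by rewrite /row_class hm rmorphD.
case/dvdnP => q mq; have := Vset_sub q per (or_introl (ex_intro2 _ _ i hi erefl)).
rewrite hm mq addrK => -[[j hj ej]|]; last by lia.
by have := bpos j hj; lia.
Qed.

End Partitions.

(** * Determinants of periodic partitions are tau-functions *)

Section Converse.
Variables (K : numFieldType) (n : nat) (lam : seq nat)
  (c : 'Z_n -> nat -> K).

Lemma ev_tau_detE t : ev t (tau_det lam c) =
  detsc (fun i : 'I_(size lam) => beta lam i) (fun i => c (row_class n lam i)) t.
Proof.
rewrite ev_tau_det; congr (\det _); apply/matrixP => i j; rewrite !mxE.
by congr sc; rewrite /beta; lia.
Qed.

Lemma tau_det_neq0 : sorted geq lam -> tau_det lam c != 0.
Proof.
move=> so.
have [||t ht] := @detsc_neq0 K (size lam) (fun i => beta lam i)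
  (fun i => c (row_class n lam i)).
- exact: beta_inj.
- by move=> i; apply: beta_gt.
by apply: contra ht => /eqP e; rewrite -ev_tau_detE e /ev rmorph0.
Qed.

Let horner_minus t u : (shiftm t (tau_det lam c)).[u] =
  detsc (fun i : 'I_(size lam) => beta lam i) (fun i => c (row_class n lam i))
    (fun i => t i - br u i).
Proof. by rewrite horner_shiftm ev_tau_detE. Qed.

(** For v = beta_i this is orthogonality to row i; in the tail all indices are negative. The
    constants depend only on the class of [v], so periodicity allows v - jn. *)
Lemma shiftm_kernel t v : Vset lam v ->
  \sum_(l < (size lam).+1) (shiftm t (tau_det lam c))`_l *
    sc (fun m => t m + c v%:~R m) (v + l%:Z - 1) = 0.
Proof.
case=> [[i hi ->]|hv].
  exact: (detsc_minus_kernel (horner_minus t) (Ordinal hi)).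
by rewrite big1 // => l _; rewrite sc_neg ?mulr0 //; move: (ltn_ord l); lia.
Qed.

End Converse.

(** By [detsc_plus_conv] the factor in [y] contributes a combination of rows, and z^(jn) moves
    beta_i to beta_i - jn, an element of V_lambda in the same class; [shiftm_kernel] kills each
    term. *)
Lemma tau_det_KdV (K : numFieldType) n lam (c : 'Z_n -> nat -> K) : (2 <= n)%N ->
  is_partition lam -> periodic n lam -> KdV_tau n (tau_det lam c).
Proof.
move=> n2 plam per; apply/KdV_points; split=> [|j t y].
  by apply: tau_det_neq0; case/andP: plam.
pose tau := tau_det lam c; rewrite -/tau.
pose b (i : 'I_(size lam)) := beta lam i; pose g i := c (row_class n lam i).
pose B := (\sum_(i < size lam) nth 0%N lam i).+1.
have hB i : b i < B%:Z.
  have : (nth 0%N lam i <= \sum_(i < size lam) nth 0%N lam i)%N.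
    by rewrite (bigD1 i) //= leq_addr.
  by rewrite /b /beta /B; lia.
have hP u : (shiftm t tau).[u] = detsc b g (fun m => t m - br u m).
  by rewrite horner_shiftm ev_tau_detE.
have hQ u : (shiftp y tau).[u] = detsc b g (fun m => y m + br u m).
  by rewrite horner_shiftp ev_tau_detE.
have sP := size_detsc_minus hP.
have ker v : Vset lam v -> \sum_(l < (size lam).+1) (shiftm t tau)`_l *
    sc (fun m => t m + c v%:~R m) (v + l%:Z - 1) = 0 by exact: shiftm_kernel.
clear plam hP; rewrite {}/tau in hQ sP ker *.
move: (shiftm t _) (shiftp y _) hQ sP ker => P Q hQ sP ker.
(* [detsc_plusE] expands along a first column, so the empty partition, with determinant 1, is
   treated apart. *)
case: lam per @b @g @B hB hQ sP ker => [|x lam'] per b g B hB hQ sP ker.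
  have sQ : (size Q <= 1)%N.
    rewrite (_ : Q = 1) ?size_poly1 //; apply: poly_horner_inj => u.
    by rewrite hQ hornerC /detsc det_mx00.
  rewrite (residueM _ _ sP sQ) !big_ord1 /= sc_neg ?mulr0 //; lia.
set lam := x :: lam' in per b g B hB hQ sP ker *.
have sQ : (size Q <= B)%N by rewrite (detsc_plusE hQ hB) size_poly.
rewrite (residueM _ _ sP sQ).
transitivity (\sum_(l < (size lam).+1) P`_l * \sum_i pcof b g y i *
    sc (fun m => t m + g i m) (b i - (j * n)%N%:Z + l%:Z - 1)).
  apply: eq_bigr => l _; congr (_ * _).
  rewrite (eq_bigr (fun m : 'I_B => Q`_m *
     sc (fun i => t i - y i) ((l%:Z - (j * n)%N%:Z) + m%:Z - 1))).
    rewrite (detsc_plus_conv hQ hB); last first.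
      have aux (s l0 N : nat) : (l0 < s.+2)%N -> l0%:Z - N%:Z <= s.+1%:Z by lia.
      exact: (aux (size lam') l _ (ltn_ord l)).
    by apply: eq_bigr => i _; congr (_ * sc _ _); lia.
  by move=> m _; congr (_ * sc _ _); lia.
under eq_bigr => l _ do rewrite mulr_sumr.
rewrite exchange_big /= big1 // => i _.
under eq_bigr => l _ do rewrite mulrCA.
rewrite -mulr_sumr.
have := ker _ (Vset_sub j per (or_introl (ex_intro2 _ _ (i : nat) (ltn_ord i) erefl))).
by rewrite class_sub // => ->; rewrite mulr0.
Qed.

Lemma sorted_ltn_gap (s : seq nat) i j : sorted ltn s -> (i <= j < size s)%N ->
  (nth 0 s i + (j - i) <= nth 0 s j)%N.
Proof.
move=> so /andP[ij js]; elim: j ij js => [|j IH] ij js.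
  by move: ij; rewrite leqn0 => /eqP ->; rewrite subnn addn0.
move: ij; rewrite leq_eqVlt => /orP[/eqP -> | ij]; first by rewrite subnn addn0.
have := IH ij (ltnW js); have := @sorted_ltn_nth _ _ ltn_trans 0%N s so j j.+1.
by rewrite !inE js (ltnW js) ltnSn => /(_ isT isT isT); lia.
Qed.

(** * The orthogonal space W and its orders of vanishing *)

Section Grassmannian.
Variables (K : numFieldType) (n : nat) (tau : tpoly K) (k M : nat).
Implicit Types (t y : nat -> K) (g : nat -> K).

Local Notation L := (M + k)%N.

(* The coefficient of z^i in exp (\sum_m t_m z^m) z^(-M) g(z), for i < k *)
Definition gconv t g (i : int) : K :=
  \sum_(q < L) g q * sc t (i + M%:Z - q%:Z).

(* z^(-M) g(z), taken modulo z^k, is orthogonal to all z^(jn) psi(t, z) where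
   psi(t, z) = tau(t - [z^-1]) exp (\sum_m t_m z^m). *)
Definition inW g := forall t j,
  \sum_(l < k.+1) (shiftm t tau)`_l * gconv t g (l%:Z - 1 - (j * n)%N%:Z) = 0.

Lemma gconv_lin m (v : 'I_m -> K) (g : 'I_m -> nat -> K) t i :
  gconv t (fun q => \sum_a v a * g a q) i = \sum_a v a * gconv t (g a) i.
Proof.
rewrite /gconv; under [RHS]eq_bigr => a _ do rewrite mulr_sumr.
rewrite exchange_big; apply: eq_bigr => q _ /=; rewrite mulr_suml.
by apply: eq_bigr => a _; rewrite mulrA.
Qed.

Lemma inW_lin m (v : 'I_m -> K) (g : 'I_m -> nat -> K) :
  (forall a, inW (g a)) -> inW (fun q => \sum_a v a * g a q).
Proof.
move=> hg t j; under eq_bigr => l _ do rewrite gconv_lin mulr_sumr.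
rewrite exchange_big big1 //= => a _.
have E := congr1 ( *%R (v a)) (hg a t j); rewrite mulr0 mulr_sumr in E.
apply: etrans E; by apply: eq_bigr => l _; rewrite mulrCA.
Qed.

(* The coefficient of z^q in z^M psi*(y, z) *)
Definition dualpsi y (q : nat) : K :=
  \sum_(m < M.+1) (shiftp y tau)`_m * sc (fun i => - y i) (m%:Z - M%:Z + q%:Z).

(** The two exponentials combine by [scD]; the bound on [i] makes the [L] retained terms
    sufficient. *)
Lemma gconv_dualpsi t y i : i < k%:Z -> gconv t (dualpsi y) i =
  \sum_(m < M.+1) (shiftp y tau)`_m * sc (fun i => t i - y i) (i + m%:Z).
Proof.
move=> hi; rewrite /gconv /dualpsi; under eq_bigr => q _ do rewrite mulr_suml.
rewrite exchange_big; apply: eq_bigr => m _ /=.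
rewrite (_ : i + m%:Z = (i + M%:Z) + (m%:Z - M%:Z)); last lia.
rewrite -(@scD K t (fun i => - y i) _ _ L); [|by move: (ltn_ord m); lia|lia].
by rewrite mulr_sumr; apply: eq_bigr => q _; rewrite -mulrA [X in _ * X]mulrC.
Qed.

(* [p] is a pivot iff M - p lies in V_lambda for the partition lambda sought. *)
Definition pivot (p : nat) := exists g, [/\ inW g,
  forall q, (q < p)%N -> g q = 0 & g p != 0].

Definition pivots := [seq p <- iota 0 L | `[< pivot p >]].

Lemma mem_pivots p : (p \in pivots) <-> (p < L)%N /\ pivot p.
Proof.
rewrite mem_filter mem_iota add0n /=; split=> [/andP[/asboolP]|[? ?]] //.
by apply/andP; split=> //; apply/asboolP.
Qed.

Lemma pivots_sorted : sorted ltn pivots.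
Proof. exact/sorted_filter/iota_ltn_sorted/ltn_trans. Qed.

Lemma gconv_pivot t g p i : (p < L)%N -> (forall q, (q < p)%N -> g q = 0) ->
  gconv t g i = \sum_(m < L - p) g (p + m)%N * sc t (i + M%:Z - p%:Z - m%:Z).
Proof.
move=> hp g0; rewrite /gconv.
rewrite -(big_mkord xpredT (fun q => g q * sc t (i + M%:Z - q%:Z))).
rewrite (big_cat_nat (n := p)) //=; last exact: ltnW.
rewrite big_nat big1 ?add0r; last by move=> q /andP[_ h]; rewrite g0 ?mul0r.
rewrite -{1}[p]add0n big_addn big_mkord; apply: eq_bigr => m _.
by rewrite addnC; congr (_ * sc _ _); lia.
Qed.

(** Multiplication by z^n turns the condition at [j] into the one at j + 1. *)
Lemma inW_shift g : inW g -> inW (fun q => if (q < n)%N then 0 else g (q - n)%N).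
Proof.
move=> Wg t j; apply: etrans (Wg t j.+1); apply: eq_bigr => l _; congr (_ * _).
pose h q := g q * sc t (l%:Z - 1 - (j.+1 * n)%N%:Z + M%:Z - q%:Z).
rewrite /gconv -(big_mkord xpredT h) -(big_mkord xpredT (fun q =>
  (if (q < n)%N then 0 else g (q - n)%N) * sc t (l%:Z - 1 - (j * n)%N%:Z + M%:Z - q%:Z))).
(* Entries pushed beyond the truncation only meet Schur polynomials of negative index. *)
have h0 q : (M + k - n <= q)%N -> h q = 0.
  by move=> hq; rewrite /h sc_neg ?mulr0 //; move: (ltn_ord l); lia.
have [nL|nL] := leqP n (M + k); last first.
  rewrite big_nat big1 => [|q /andP[_ hq]]; last by rewrite ifT ?mul0r //; lia.
  by rewrite big_nat big1 // => q _; apply: h0; lia.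
rewrite (big_cat_nat (n := n)) //= big_nat big1 ?add0r; last first.
  by move=> q /andP[_ ->]; rewrite mul0r.
rewrite -{1}[n]add0n big_addn.
rewrite [RHS](big_cat_nat (n := (M + k - n)%N)) //=; last exact: leq_subr.
rewrite [X in _ = _ + X]big_nat [X in _ = _ + X]big1 ?addr0; last first.
  by move=> q /andP[hq _]; apply: h0.
apply: eq_bigr => q _; rewrite ifF ?addnK /h; last by apply/negbTE; rewrite -leqNgt leq_addl.
by congr (_ * sc _ _); lia.
Qed.

Hypothesis tau0 : tau != 0.
Hypothesis tauB : forall j t y, residue (j * n)
  (shiftm t tau * shiftp y tau) (sc (fun i => t i - y i)) = 0.
Hypothesis sP : forall t, (size (shiftm t tau) <= k.+1)%N.
Hypothesis sQ : forall y, (size (shiftp y tau) <= M.+1)%N.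

(** This is the bilinear identity, with the residue split by [residueM]. *)
Lemma inW_dualpsi y : inW (dualpsi y).
Proof.
move=> t j; apply: etrans (tauB j t y); rewrite (residueM _ _ (sP t) (sQ y)).
apply: eq_bigr => l _; congr (_ * _).
rewrite gconv_dualpsi; last by move: (ltn_ord l) (j * n)%N => ? N; lia.
by apply: eq_bigr => m _; congr (_ * sc _ _); lia.
Qed.

(* The [x]-shifted wave functions are seen at [z] as a Vandermonde family. *)
Lemma gconv_dualpsi_br z x (e : nat) : (e < k)%N ->
  gconv z (dualpsi (fun i => z i - br x i)) e = x ^+ e * ev z tau.
Proof.
move=> he; rewrite gconv_dualpsi //.
have -> : ev z tau = (shiftp (fun i => z i - br x i) tau).[x].
  by rewrite horner_shiftp; apply: peval_ext => // i; rewrite subrK.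
rewrite (horner_coef_wide _ (sQ _)) mulr_sumr; apply: eq_bigr => m _.
rewrite mulrCA -exprD -sc_geom; congr (_ * _); apply: sc_ext => i.
by rewrite opprB addrC subrK.
Qed.

(** With fewer than [k] pivots, a nontrivial combination of [k] dual wave functions vanishes at all
    pivots, hence below [L]. At [z] it becomes a Vandermonde relation times the nonzero value
    tau(z). *)
Lemma size_pivots_ge : (k <= size pivots)%N.
Proof.
have [z hz] := ev_neq0 tau0; rewrite leqNgt; apply/negP => lt.
pose x (a : 'I_k) : K := a%:R.
pose g a := dualpsi (fun i => z i - br (x a) i).
pose N : 'M[K]_(k, size pivots) := \matrix_(a, s) g a (nth 0%N pivots s).
have /rowV0Pn [v /sub_kermxP vN v0] : kermx N != 0.
  rewrite kermx_eq0 -row_leq_rank -ltnNge.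
  exact: leq_ltn_trans (rank_leq_col _) lt.
pose G q := \sum_a v 0 a * g a q.
have WG : inW G by apply: inW_lin => a; apply: inW_dualpsi.
(* The first index below [L] at which an element of W is nonzero is a pivot. *)
have G0 q : (q < L)%N -> G q = 0.
  elim/ltn_ind: q => q IH hq; apply/eqP/negPn/negP => Gq.
  have : q \in pivots.
    apply/mem_pivots; split=> //; exists G; split=> // q' hq'.
    exact: IH (ltn_trans hq' hq).
  case/(nthP 0%N) => s hs e; case/eqP: Gq.
  have := congr1 (fun A : 'rV_(size pivots) => A 0 (Ordinal hs)) vN.
  rewrite !mxE => E; apply: etrans E; apply: eq_bigr => a _.
  by rewrite mxE /= e.
pose V := Vandermonde k (\row_a x a).
have uV : V \in unitmx.
  by apply: unitmx_Vandermonde => a b /eqP; rewrite eqr_nat => /eqP /val_inj.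
case/eqP: v0; apply: (can_inj (mulmxK (_ : V^T \in unitmx))); first by rewrite unitmx_tr.
rewrite mul0mx; apply/rowP => e; rewrite !mxE.
apply: (mulIf hz); rewrite mul0r mulr_suml.
have := gconv_lin (fun a => v 0 a) g z e.
rewrite {1}/gconv big1 => [E|q _]; last by rewrite -/(G q) G0 ?mul0r.
apply: etrans (esym E); apply: eq_bigr => a _.
by rewrite gconv_dualpsi_br // !mxE mulrA.
Qed.

(** k + 1 elements of W with distinct orders give a square system that kills the coefficients of
    tau(t - [u]), among them tau(t); its determinant is not identically zero by [det_sc_neq0]. *)
Lemma size_pivots_le : (size pivots <= k)%N.
Proof.
rewrite leqNgt; apply/negP => lt.
pose p (i : 'I_k.+1) := nth 0%N pivots i.
have hpm i : p i \in pivots by apply: mem_nth; exact: leq_trans (ltn_ord i) lt.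
have hp i : (p i < L)%N /\ pivot (p i) by exact/mem_pivots.
have [g hg] := choice (fun i => proj2 (hp i)).
(* [L.-1 - p i] counts the retained coefficients of [g i] after the leading one. *)
have [||t ht] := @det_sc_neq0 K k.+1 (fun i m => g i (p i + m)%N) (fun i => (L.-1 - p i)%N).
- by move=> i; rewrite addn0; case: (hg i).
- have ups := sorted_uniq ltn_trans ltnn pivots_sorted.
  move=> i j e; apply/val_inj/eqP; rewrite -(nth_uniq 0%N _ _ ups).
  + by apply/eqP; have [? _] := hp i; have [? _] := hp j; rewrite -/(p i) -/(p j); lia.
  + exact: leq_trans (ltn_ord i) lt.
  + exact: leq_trans (ltn_ord j) lt.
pose D t := \det (\matrix_(i < k.+1, j < k.+1) gconv t (g i) (j%:Z - 1)).
have Dt : D t != 0.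
  apply: contra ht => /eqP E; apply/eqP; apply: etrans E; congr (\det _).
  apply/matrixP => i j; rewrite !mxE; have [hL _] := hp i; have [_ g0 _] := hg i.
  rewrite (gconv_pivot _ _ hL g0) (_ : (L - p i = (L.-1 - p i).+1)%N); last lia.
  by apply: eq_bigr => m _; congr (_ * sc _ _); move: (ltn_ord j); lia.
have [z hz] := ev_neq0 tau0; case/eqP: hz.
apply: (@linepoly_mul_eq0 K D (fun t => ev t tau)); last by exists t.
- apply: linepoly_det => i j; apply: linepoly_sum => q; apply: linepolyM.
    exact: linepoly_cst.
  exact: linepoly_sc.
- exact: linepoly_ev.
move=> {ht Dt} {}t; rewrite -shiftm0.
rewrite /D; set A := (X in \det X).
pose v : 'cV[K]_k.+1 := \col_l (shiftm t tau)`_l.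
have Av : A *m v = 0.
  apply/colP => i; rewrite !mxE; have [Wg _ _] := hg i.
  apply: etrans (Wg t 0%N); apply: eq_bigr => l _; rewrite !mxE mulrC mul0n.
  by rewrite subr0.
have := congr1 (fun B => (\adj A *m B) ord0 ord0) Av.
by rewrite mulmxA mul_adj_mx mulmx0 mul_scalar_mx !mxE.
Qed.

Lemma size_pivots : size pivots = k.
Proof. by apply/eqP; rewrite eqn_leq size_pivots_le size_pivots_ge. Qed.

End Grassmannian.

(** * From the pivots to the partition and the constants *)

Section PivotPartition.
Variables (K : numFieldType) (n : nat) (tau : tpoly K) (k M : nat).
Hypothesis tau0 : tau != 0.
Hypothesis tauB : forall j t y, residue (j * n)
  (shiftm t tau * shiftp y tau) (sc (fun i => t i - y i)) = 0.
Hypothesis sP : forall t, (size (shiftm t tau) <= k.+1)%N.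
Hypothesis sQ : forall y, (size (shiftp y tau) <= M.+1)%N.

Local Notation ps := (pivots n tau k M).
Local Notation W := (inW n tau k M).

(** Chosen so that [beta] is M - p_i, minus an order of vanishing. The last parts may be 0;
    [tau_det_trim] removes them. *)
Definition pivot_part := mkseq (fun i => (M + i - nth 0%N ps i)%N) k.

Let size_ps : size ps = k.
Proof. exact: size_pivots. Qed.

Let ps_sorted : sorted ltn ps := pivots_sorted n tau k M.

(** The later pivots must fit below M + k. The natural subtraction in [pivot_part] is therefore
    exact. *)
Let ps_le i : (i < k)%N -> (nth 0%N ps i <= M + i)%N.
Proof.
move=> hi; have := @sorted_ltn_gap ps i k.-1 ps_sorted.
have : nth 0%N ps k.-1 \in ps by apply: mem_nth; rewrite size_ps; lia.
move/mem_pivots => [h _]; rewrite size_ps.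
have -> : (i <= k.-1 < k)%N by lia.
by move=> /(_ isT); lia.
Qed.

Lemma beta_pivot_part i : (i < k)%N ->
  beta pivot_part i = M%:Z - (nth 0%N ps i)%:Z.
Proof.
by move=> hi; rewrite /beta nth_mkseq //; have := ps_le hi; lia.
Qed.

Lemma pivot_part_sorted : sorted geq pivot_part.
Proof.
apply/(sortedP 0%N) => i; rewrite size_mkseq => hi.
rewrite !nth_mkseq ?(ltnW hi) // /geq /=.
have := @sorted_ltn_nth _ _ ltn_trans 0%N ps ps_sorted i i.+1.
rewrite !inE size_ps hi (ltnW hi) => /(_ isT isT (ltnSn i)).
by have := ps_le hi; lia.
Qed.

(** W is stable under z^n; a pivot moved to M + k or beyond corresponds to a value at most -k, in
    the tail of V_lambda. *)
Lemma pivot_part_periodic : periodic n pivot_part.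
Proof.
have hsz : size pivot_part = k by rewrite size_mkseq.
move=> v; rewrite /Vset hsz => -[[i hi ->]|hv]; last by right; lia.
rewrite beta_pivot_part //.
have [hp|hp] := ltnP (nth 0%N ps i + n) (M + k); last by right; lia.
left; have /mem_pivots [_ [g [Wg g0 gp]]] : nth 0%N ps i \in ps.
  by apply: mem_nth; rewrite size_ps.
have : (nth 0%N ps i + n)%N \in ps.
  apply/mem_pivots; split=> //; exists (fun q => if (q < n)%N then 0 else g (q - n)%N).
  split; first exact: inW_shift.
    by move=> q hq; case: ltnP => // h; apply: g0; lia.
  by rewrite ifF ?addnK //; apply/negbTE; lia.
case/(nthP 0%N) => i' hi' e; rewrite size_ps in hi'.
by exists i' => //; rewrite beta_pivot_part // e; lia.
Qed.

Hypothesis n2 : (2 <= n)%N.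

(** In each class, the element of W with the least pivot p0, divided by its leading coefficient, is
    an exponential to the needed order. For a pivot p0 + qn the relation is the orthogonality of
    this element at exponent [q]. *)
Lemma pivot_constants : exists c : 'Z_n -> nat -> K, forall i t, (i < k)%N ->
  \sum_(l < k.+1) (shiftm t tau)`_l *
    sc (fun m => t m + c (row_class n pivot_part i) m)
       (beta pivot_part i + l%:Z - 1) = 0.
Proof.
suff /choice [c hc] : forall r : 'Z_n, exists c : nat -> K, forall p t, p \in ps ->
    (M%:Z - p%:Z)%:~R = r -> \sum_(l < k.+1) (shiftm t tau)`_l *
    sc (fun m => t m + c m) (M%:Z - p%:Z + l%:Z - 1) = 0.
  exists c => i t hi; rewrite /row_class beta_pivot_part //; apply: hc => //.
  by apply: mem_nth; rewrite size_ps.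
move=> r; pose Q p := (p \in ps) && ((M%:Z - p%:Z)%:~R == r).
have [exQ|nQ] := pselect (exists p, Q p); last first.
  (* A class without pivots labels no row; zero is a default. *)
  by exists (fun=> 0) => p t hp /eqP hr; case: nQ; exists p; rewrite /Q hp.
case: (ex_minnP exQ) => p0 /andP[hp0 /eqP hr0] minp.
have /mem_pivots [p0L [g [Wg g0 gp]]] := hp0.
have s0 : g (p0 + 0)%N / g p0 = 1 by rewrite addn0 divff.
have [c hc] := @sc_surj K (fun m => g (p0 + m)%N / g p0) s0 (M + k).
exists c => p t hp hr.
have le0 : (p0 <= p)%N by apply: minp; rewrite /Q hp hr eqxx.
have [q hq] : exists q, p = (p0 + q * n)%N.
  have : (n %| p - p0)%N.
    rewrite -natZn_eq0 //; apply/eqP.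
    have -> : ((p - p0)%:R : 'Z_n) = (M%:Z - p0%:Z)%:~R - (M%:Z - p%:Z)%:~R.
      by rewrite -rmorphB /= (_ : _ - _ = (p - p0)%N%:Z) //; lia.
    by rewrite hr hr0 subrr.
  by case/dvdnP => q e; exists q; lia.
apply: (mulfI gp); rewrite mulr0; apply: etrans (Wg t q).
rewrite mulr_sumr; apply: eq_bigr => l _; rewrite mulrCA; congr (_ * _).
rewrite (gconv_pivot _ _ p0L g0).
rewrite -[_ - 1]addr0 -(@scD K t c _ 0 (M + k - p0)) //; last first.
  by move: (ltn_ord l); lia.
rewrite mulr_sumr; apply: eq_bigr => m _; rewrite add0r hc; last first.
  by move: (ltn_ord m); lia.
rewrite mulrCA [g p0 * _]mulrCA divff // mulr1 mulrC; congr (_ * sc _ _).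
by rewrite hq; lia.
Qed.

(** [bordered_kernel], with the coefficients of tau(t - [u]) as kernel vector, provides the
    hypothesis of [proportional]. *)
Lemma KdV_pivot_part : exists (c : 'Z_n -> nat -> K) (a : K),
  a != 0 /\ tau = a *: tau_det pivot_part c.
Proof.
have [c hc] := pivot_constants.
have [a ha] : exists a, tau_det pivot_part c = a *: tau.
  apply: proportional => // t u; rewrite !ev_tau_detE -horner_shiftm detsc_sub_br.
  have hsz : size pivot_part = k by rewrite size_mkseq.
  have sP' : (size (shiftm t tau) <= (size pivot_part).+1)%N by rewrite hsz.
  rewrite (horner_coef_wide _ sP') -shiftm0 /detsc.
  pose F (i : 'I_(size pivot_part)) (l : nat) :=
    sc (fun m => t m + c (row_class n pivot_part i) m) (beta pivot_part i + l%:Z - 1).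
  rewrite -(@bordered_kernel K _ F (fun l => (shiftm t tau)`_l)).
    congr (_ * \det _); apply/matrixP => i j; rewrite !mxE /F.
    by congr sc; lia.
  by move=> i; rewrite hsz; apply: hc; rewrite -hsz.
have t0 := tau_det_neq0 c pivot_part_sorted.
have a0 : a != 0 by apply: contra t0 => /eqP a0; rewrite ha a0 scale0r.
exists c, a^-1; split; first by rewrite invr_eq0.
rewrite ha scalerA.
have -> : a^-1 * a = 1 by exact: mulVf.
by rewrite scale1r.
Qed.

End PivotPartition.

(** * Removal of trailing zero parts, and conclusion *)

Lemma tau_det_rcons0 (K : numFieldType) n (c : 'Z_n -> nat -> K) lam :
  tau_det (rcons lam 0%N) c = tau_det lam c.
Proof.
apply: ev_faithful => t; rewrite !ev_tau_det.
pose E i j := sc (fun m => t m + c (row_class n (rcons lam 0%N) i) m)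
       ((nth 0%N (rcons lam 0%N) i)%:Z + j%:Z - i%:Z).
rewrite -[LHS]/(\det (\matrix_(i < size (rcons lam 0%N), j < size (rcons lam 0%N)) E i j)).
(* In the last row all entries have negative index except the final one, s_0 = 1. *)
rewrite size_rcons (expand_det_row _ ord_max) big_ord_recr /= big1 ?add0r.
  rewrite mxE /E nth_rcons ltnn eqxx /= (_ : 0%:Z + _ - _ = 0) ?sc0 ?mul1r; last lia.
  rewrite /cofactor addnn -signr_odd odd_double expr0 mul1r.
  congr (\det _); apply/matrixP => i j; rewrite !mxE !lift_max /E.
  by rewrite /row_class /beta !nth_rcons ltn_ord.
move=> j _; rewrite mxE /E nth_rcons ltnn eqxx sc_neg ?mul0r //=.
by move: (ltn_ord j); lia.
Qed.

(** The extra row contributes minus the size of [lam], the largest value of the tail, so V_lambda is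
    unchanged. *)
Lemma periodic_rcons0 n lam : periodic n (rcons lam 0%N) -> periodic n lam.
Proof.
have H v : Vset (rcons lam 0%N) v <-> Vset lam v.
  rewrite /Vset size_rcons; split.
    case=> [[i hi ->]|]; last by right; lia.
    have [h|h] := ltnP i (size lam).
      by left; exists i => //; rewrite /beta nth_rcons h.
    by right; rewrite /beta nth_rcons ltnNge h /=; case: eqP; lia.
  case=> [[i hi ->]|h].
    by left; exists i; [lia|rewrite /beta nth_rcons hi].
  have [h'|h'] := lerP v (- (size lam).+1%:Z); first by right.
  left; exists (size lam) => //; rewrite /beta nth_rcons ltnn eqxx; lia.
by move=> per v /H /per /H.
Qed.

Lemma tau_det_trim (K : numFieldType) n (c : 'Z_n -> nat -> K) lam :
  sorted geq lam -> periodic n lam -> exists lam',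
  [/\ is_partition lam', periodic n lam' & tau_det lam' c = tau_det lam c].
Proof.
elim/last_ind: lam => [|lam x IH] so per; first by exists [::].
case: x so per => [|x] so per.
  have [||lam' [h1 h2 h3]] := IH.
  - exact: (subseq_sorted (rev_trans leq_trans) (subseq_rcons _ _) so).
  - exact: periodic_rcons0.
  by exists lam'; rewrite tau_det_rcons0.
exists (rcons lam x.+1); split=> //; rewrite /is_partition so /=.
apply/(all_nthP 0%N) => i hi; rewrite size_rcons in hi.
have := sorted_leq_nth (rev_trans leq_trans) leqnn 0%N so.
move=> /(_ i (size lam)); rewrite !inE size_rcons hi ltnSn => /(_ isT isT hi).
by rewrite [nth _ _ (size lam)]nth_rcons ltnn eqxx /geq /=; lia.
Qed.

Lemma KdV_tau_det (K : numFieldType) n (tau : tpoly K) : (2 <= n)%N ->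
  KdV_tau n tau -> exists (lam : seq nat) (c : 'Z_n -> nat -> K) (a : K),
    [/\ is_partition lam, periodic n lam, a != 0 & tau = a *: tau_det lam c].
Proof.
move=> n2 /KdV_points [tau0 tauB]; have [d hd] := size_pshift tau.
(* The same degree bound [d] is taken for both truncation parameters, [k] and [M]. *)
have sP t : (size (shiftm t tau) <= d.+1)%N by apply: leqW; exact: hd.
have sQ t : (size (shiftp t tau) <= d.+1)%N by apply: leqW; exact: hd.
have [c [a [a0 ->]]] := KdV_pivot_part tau0 tauB sP sQ n2.
have [lam [h1 h2 h3]] := tau_det_trim c
  (pivot_part_sorted tau0 tauB sP sQ) (pivot_part_periodic tau0 tauB sP sQ).
by exists lam, c, a; rewrite h3.
Qed.

Theorem theorem6 (R : realType) (n : nat) (hn : (2 <= n)%N) :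
  (forall tau : tpoly R[i], KdV_tau n tau ->
     exists (lam : seq nat) (c : 'Z_n -> nat -> R[i]) (a : R[i]),
       [/\ is_partition lam, periodic n lam, a != 0
         & tau = a *: tau_det lam c])
  /\ (forall (lam : seq nat) (c : 'Z_n -> nat -> R[i]),
        is_partition lam -> periodic n lam -> KdV_tau n (tau_det lam c))
  /\ (forall lam : seq nat, is_partition lam -> periodic n lam ->
        (size (undup [seq row_class n lam i | i <- iota 0 (size lam)])
           <= n.-1)%N).
Proof.
split; first by move=> tau; apply: KdV_tau_det.
split; first by move=> lam c; apply: tau_det_KdV.
by move=> lam; apply: size_row_classes.
Qed.
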